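(* Let $F$ be a field with $\operatorname{char}F\neq2$. The following are equivalent: (1) there is a Galois extension $K/F$ with $\operatorname{Gal}(K/F)\cong D\curlywedge D$; (2) there is a Galois extension $L/F$ with $\operatorname{Gal}(L/F)\cong G_2$; (3) there exist $a,b,c\in F$ with $[F(\sqrt a,\sqrt b,\sqrt c):F]=8$ and $(a,b)_F=(a,c)_F=0$ in $Br(F)$; (4) there exist $a,b,c\in\dot F\setminus\dot F^2$, independent modulo squares, with $b,c\in D_F(\langle1,-a\rangle)$; (5) there exists $a\in\dot F\setminus\dot F^2$ such that either $|D_F(\langle1,-a\rangle)/\dot F^2|\ge8$, or both $|D_F(\langle1,-a\rangle)/\dot F^2|=4$ and $a\notin D_F(\langle1,1\rangle)$.
   Context: $\dot F=F\setminus\{0\}$; $D_F(q)$ is the set of elements of $\dot F$ represented by a quadratic form $q$; $\langle a_1,a_2\rangle$ is $a_1x_1^2+a_2x_2^2$. $(a,b)_F$ is the class of the quaternion algebra in $Br(F)$. $D$ is the dihedral group of order 8. $D\curlywedge D$ is the pullback of two homomorphisms $\lambda_1,\lambda_2:D\to\mathbb Z/2\mathbb Z$, each with kernel isomorphic to $\mathbb Z/2\times\mathbb Z/2$: $\{(u,v)\in D\times D:\lambda_1(u)=\lambda_2(v)\}$, of order 32. Commutators $[\sigma,\tau]=\sigma^{-1}\tau^{-1}\sigma\tau$. $G_2$ is the group generated by $x,y,z$ with relations $x^2=y^2=z^2=1$, $[x,y]^2=[x,z]^2=[y,z]=1$, $[y,[x,z]]=[z,[x,y]]$, this element having order dividing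 2 and commuting with $x,y,z$. *)

(* Defs.v *)
From HB Require Import structures.
From mathcomp Require Import all_boot all_order all_algebra all_fingroup all_solvable all_field.
Set Implicit Arguments. Unset Strict Implicit. Unset Printing Implicit Defensive.
Import GRing.Theory.
Local Open Scope ring_scope.

Section SquareClasses.
Variable F : fieldType.

Definition nz_square (y : F) : Prop := exists x : F, x != 0 /\ y = x ^+ 2.

Definition eq_mod_sq (x y : F) : Prop := exists z : F, z != 0 /\ x = y * z ^+ 2.

Definition indep_mod_sq3 (a b c : F) : Prop :=
  forall e1 e2 e3 : bool, [|| e1, e2 | e3] ->
    ~ nz_square (a ^+ e1 * b ^+ e2 * c ^+ e3).

Definition DF2 (a1 a2 : F) (y : F) : Prop :=
  y != 0 /\ exists x1 x2 : F, y = a1 * x1 ^+ 2 + a2 * x2 ^+ 2.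

Definition sqclass_card_ge (S : F -> Prop) (n : nat) : Prop :=
  exists s : seq F, size s = n /\ (forall i, (i < n)%N -> S (nth 0 s i)) /\
    forall i j, (i < n)%N -> (j < n)%N -> (i != j)%N ->
      ~ eq_mod_sq (nth 0 s i) (nth 0 s j).

Definition sqclass_card_eq (S : F -> Prop) (n : nat) : Prop :=
  sqclass_card_ge S n /\ ~ sqclass_card_ge S n.+1.

(* element x0 + x1 i + x2 j + x3 k, with i^2 = a, j^2 = b, k = ij = -ji *)
Definition quat := (F * F * F * F)%type.

Definition qadd (x y : quat) : quat :=
  let: (x0, x1, x2, x3) := x in let: (y0, y1, y2, y3) := y in
  (x0 + y0, x1 + y1, x2 + y2, x3 + y3).

Definition qscale (c : F) (x : quat) : quat :=
  let: (x0, x1, x2, x3) := x in (c * x0, c * x1, c * x2, c * x3).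

Definition qone : quat := (1, 0, 0, 0).

Definition qmul (a b : F) (x y : quat) : quat :=
  let: (x0, x1, x2, x3) := x in let: (y0, y1, y2, y3) := y in
  (x0 * y0 + a * x1 * y1 + b * x2 * y2 - a * b * x3 * y3,
   x0 * y1 + x1 * y0 - b * x2 * y3 + b * x3 * y2,
   x0 * y2 + x2 * y0 + a * x1 * y3 - a * x3 * y1,
   x0 * y3 + x3 * y0 + x1 * y2 - x2 * y1).

(* (a,b)_F = 0 in Br(F): the quaternion algebra (a,b)_F is isomorphic,
   as an F-algebra, to the matrix algebra M_2(F). *)
Definition quat_split (a b : F) : Prop :=
  exists phi : quat -> 'M[F]_2,
    bijective phi /\
    (forall x y, phi (qadd x y) = phi x + phi y) /\
    (forall c x, phi (qscale c x) = c *: phi x) /\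
    phi qone = 1%:M /\
    (forall x y, phi (qmul a b x y) = phi x *m phi y).

Definition deg_sqrt3 (a b c : F) (n : nat) : Prop :=
  exists (L : fieldExtType F) (al be ga : L),
    al ^+ 2 = a%:A /\ be ^+ 2 = b%:A /\ ga ^+ 2 = c%:A /\
    \dim <<1 & [:: al; be; ga]>>%VS = n.

Definition has_galois_ext (P : forall L : splittingFieldType F,
    {set gal_of (fullv : {vspace L})} -> Prop) : Prop :=
  exists L : splittingFieldType F,
    galois (1%VS : {vspace L}) fullv /\ P L 'Gal(fullv / (1%VS : {vspace L}))%g.

End SquareClasses.

Local Open Scope group_scope.

Definition pullback (l1 l2 : {morphism [set: gsort 'D_8] >-> 'Z_2}) :
    {set ('D_8 * 'D_8)%type} :=
  [set uv : ('D_8 * 'D_8)%type | l1 uv.1 == l2 uv.2].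

Definition isog_DwedgeD (gT : finGroupType) (G : {set gT}) : Prop :=
  exists l1 l2 : {morphism [set: gsort 'D_8] >-> 'Z_2},
    ('ker l1 \isog [set: ('Z_2 * 'Z_2)%type]) /\
    ('ker l2 \isog [set: ('Z_2 * 'Z_2)%type]) /\
    G \isog pullback l1 l2.

Definition isog_G2 (gT : finGroupType) (G : {set gT}) : Prop :=
  G \isog Grp (x : y : z :
    x ^+ 2, y ^+ 2, z ^+ 2, [~ x, y] ^+ 2, [~ x, z] ^+ 2, [~ y, z],
    [~ y, [~ x, z]] = [~ z, [~ x, y]],
    [~ y, [~ x, z]] ^+ 2,
    [~ [~ y, [~ x, z]], x], [~ [~ y, [~ x, z]], y], [~ [~ y, [~ x, z]], z]).

(* Main.v *)
(** For [a = r ^ 2], a pair [b = N(beta)], [c = N(gamma)] of norms from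
    [F(r)] yields the field [M = F(r, s1, s2, t1, t2)] obtained by adjoining
    the square roots of [beta], [gamma] and of their conjugates; independence
    of [a, b, c] makes its group the wreath-like group DwedgeD.  Since [beta] and
    the conjugate of [gamma] form a basis of [F(r)] over [F], rescaling them by
    elements of [F] achieves [beta + conj gamma = 1], and then
    [(1 + s1) (1 - s1) = 1 - beta] is the square [t2 ^ 2].  This makes
    [L = M(sqrt ((1 + s1) (1 + s2)))] Galois over [F]: the conjugate of the
    radicand under [s1 -> - s1] differs from it by the square of
    [t2 / (1 + s1)].  The commutators do not act trivially on the new square
    root, which gives the group G2.  Conversely both groups map onto DwedgeD,
    where an index 2 subgroup [E] carries characters conjugate under
    [x \notin E]; the corresponding square roots exhibit [b] and [c] as norms
    from the fixed field [F(sqrt a)] of [E].  The rest is the classical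
    dictionary between norms from [F(sqrt a)], splitting of [(a, b)] and
    square classes, where [-1] being a norm means that [a] is a sum of two
    squares. *)
Require Import Defs.
From HB Require Import structures.
From mathcomp Require Import all_boot all_order all_algebra all_fingroup all_solvable all_field.
From mathcomp Require Import ring.
From Stdlib Require Import Classical.
Import GRing.Theory.
Set Implicit Arguments. Unset Strict Implicit. Unset Printing Implicit Defensive.
Local Open Scope ring_scope.

(** * Square roots in field extensions *)

(** The radicand is a product because the automorphism [X] lifting the conjugation of [F(r)]
    exchanges [s1] and [s2]: it preserves [(1 + s1) (1 + s2)], but neither factor. The commutator of
    [X] with the automorphism [Z] that negates [t1] alone negates [t2] as well, hence also the
    factor [t2 / (1 + s1)] by which [Y : s1 -> - s1] multiplies the new square root. This sign is
    the action of [[~ y, [~ x, z]]]. The degrees 32 and 64 are reached by a squeeze: each square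
    root at most doubles the dimension, while explicit automorphisms bound the Galois group from
    below. When the bounds meet, no root has degenerated and the automorphisms generate the whole
    group. The groups are identified by counting as well: the relations allow at most 32 times the
    order of [[~ y, [~ x, z]]] elements, and the same bound applied to pairs of solutions forces two
    groups of maximal order to agree. *)

Lemma adjoin_sqrt (F : fieldType) (L : fieldExtType F) (d : L) :
  exists (L' : fieldExtType F) (f : {rmorphism L -> L'}),
    (forall k : F, f k%:A = k%:A) /\ exists s, s ^+ 2 = f d.
Proof.
have [[s Ds]|nsq] := classic (exists s, s ^+ 2 = d).
  by exists L, idfun; split=> //; exists s.
have szp : size ('X^2 - d%:P) = 3%N by rewrite size_XnsubC.
have irr : irreducible_poly ('X^2 - d%:P).
  apply: cubic_irreducible => [|x]; first by rewrite szp.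
  apply/negP => /rootP; rewrite !hornerE => /eqP; rewrite subr_eq0 => /eqP e.
  by apply: nsq; exists x.
have [K _ [x rx _]] := irredp_FAdjoin irr.
exists (baseFieldType K), (in_alg K).
split=> [k|]; first by rewrite baseField_scaleE.
exists x; move/rootP: rx; rewrite rmorphB /= map_polyXn map_polyC /= !hornerE.
by move/eqP; rewrite subr_eq0 => /eqP.
Qed.

Lemma tower_exists (F : fieldType) (a p q : F) :
  exists (L : fieldExtType F) (r s1 s2 t1 t2 d : L),
    [/\ r ^+ 2 = a%:A, s1 ^+ 2 = p%:A + q%:A * r, s2 ^+ 2 = p%:A - q%:A * r,
        t1 ^+ 2 = 1 - s2 ^+ 2 & t2 ^+ 2 = 1 - s1 ^+ 2] /\
    d ^+ 2 = (1 + s1) * (1 + s2).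
Proof.
have [L1 [f1 [f1k [r Dr]]]] := @adjoin_sqrt F F^o a%:A.
rewrite f1k in Dr.
have [L2 [f2 [f2k [s1 Ds1]]]] := @adjoin_sqrt F L1 (p%:A + q%:A * r).
have [L3 [f3 [f3k [s2 Ds2]]]] := @adjoin_sqrt F L2 (p%:A - q%:A * f2 r).
have [L4 [f4 [f4k [t1 Dt1]]]] := @adjoin_sqrt F L3 (1 - s2 ^+ 2).
have [L5 [f5 [f5k [t2 Dt2]]]] := @adjoin_sqrt F L4 (1 - (f4 (f3 s1)) ^+ 2).
have [L6 [f6 [f6k [d Dd]]]] :=
  @adjoin_sqrt F L5 ((1 + f5 (f4 (f3 s1))) * (1 + f5 (f4 s2))).
exists L6, (f6 (f5 (f4 (f3 (f2 r))))), (f6 (f5 (f4 (f3 s1)))), (f6 (f5 (f4 s2))),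
  (f6 (f5 t1)), (f6 t2), d.
split; first split; rewrite -?rmorphXn /=.
- by rewrite Dr f2k f3k f4k f5k f6k.
- by rewrite Ds1 !(rmorphD, rmorphM) /= f2k f2k f3k f3k f4k f4k f5k f5k f6k f6k.
- by rewrite Ds2 !(rmorphB, rmorphM) /= f3k f3k f4k f4k f5k f5k f6k f6k.
- by rewrite Dt1 !(rmorphB, rmorph1).
- by rewrite Dt2 !(rmorphB, rmorph1) /= !rmorphXn.
- by rewrite Dd !(rmorphM, rmorphD, rmorph1).
Qed.

Section SquareRootTowers.
Variables (F : fieldType) (L : fieldExtType F).
Hypothesis char_ne2 : (2%:R : F) != 0.
Implicit Types (K : {subfield L}) (x u v : L).

Lemma ext_char_ne2 : (2%:R : L) != 0.
Proof. by rewrite -scaler_nat scaler_eq0 negb_or char_ne2 oner_neq0. Qed.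

Lemma neq_opp x : x != 0 -> x != - x.
Proof.
move=> nzx; rewrite -subr_eq0 opprK -mulr2n -mulr_natl mulf_neq0 //.
exact: ext_char_ne2.
Qed.

Lemma adjoin_sqrt_decomp K x v :
  x ^+ 2 \in K -> v \in <<K; x>>%VS ->
  exists k0 k1, [/\ k0 \in K, k1 \in K & v = k0 + k1 * x].
Proof.
move=> Kx2 /Fadjoin_polyP[p Kp ->]; elim/poly_ind: p Kp => [|p c IHp] Kp.
  by exists 0, 0; rewrite !rpred0 horner0 mul0r addr0.
have Kc : c \in K by have := polyOverP Kp 0%N; rewrite coefD coefMX coefC add0r.
have /IHp[k0 [k1 [Kk0 Kk1 Dp]]] : p \is a polyOver K.
  apply/polyOverP => i; have := polyOverP Kp i.+1.
  by rewrite coefD coefMX coefC addr0.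
exists (k1 * x ^+ 2 + c), k0; split=> //; first by rewrite rpredD // rpredM.
by rewrite hornerMXaddC Dp; ring.
Qed.

(** Kummer theory in degree two: for [v = k0 + k1 * u] the cross term [2 k0 k1 u] of [v ^ 2] lies in
    [K], so unless [u] is already in [K] one of [k0], [k1] vanishes. *)
Lemma adjoin_sqrt_kummer K u v :
  u ^+ 2 \in K -> v ^+ 2 \in K -> v \in <<K; u>>%VS -> v \in K \/ v * u \in K.
Proof.
move=> Ku2 Kv2 /(adjoin_sqrt_decomp Ku2)[k0 [k1 [Kk0 Kk1 Dv]]].
have [Ku|K'u] := boolP (u \in K).
  by left; rewrite Dv rpredD ?rpredM.
have: (2%:R * k0 * k1) * u \in K.
  have -> : 2%:R * k0 * k1 * u = v ^+ 2 - k0 ^+ 2 - k1 ^+ 2 * u ^+ 2.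
    by rewrite Dv; ring.
  by apply: rpredB; [apply: rpredB => //; apply: rpredX|apply: rpredM; first apply: rpredX].
have [z0|nz0] := eqVneq k0 0.
  by right; rewrite Dv z0 add0r -mulrA -expr2 rpredM.
have [z1|nz1] := eqVneq k1 0.
  by left; rewrite Dv z1 mul0r addr0.
have nzc : 2%:R * k0 * k1 != 0 by rewrite !mulf_neq0 ?ext_char_ne2.
have Kc : 2%:R * k0 * k1 \in K by rewrite !rpredM ?rpred_nat.
by rewrite fpredMl // (negPf K'u).
Qed.

Lemma dim_adjoin_sqrt K x :
  x ^+ 2 \in K -> \dim <<K; x>> = (if x \in K then \dim K else 2 * \dim K)%N.
Proof.
move=> Kx2; rewrite dim_Fadjoin; case: ifP => [Kx|K'x].
  by move: Kx; rewrite -adjoin_deg_eq1 => /eqP->; rewrite mul1n.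
congr (_ * _)%N; apply/eqP; rewrite eqn_leq; apply/andP; split; last first.
  move: (negbT K'x); rewrite -adjoin_deg_eq1 /adjoin_degree.
  by case: (_.-1).
rewrite -ltnS -size_minPoly.
have szp : size ('X^2 - (x ^+ 2)%:P) = 3%N by rewrite size_XnsubC.
have nzp : 'X^2 - (x ^+ 2)%:P != 0 by rewrite -size_poly_eq0 szp.
rewrite -szp dvdp_leq // minPoly_dvdp //.
  by rewrite rpredB ?rpredX ?polyOverX // polyOverC.
by apply/rootP; rewrite !hornerE subrr.
Qed.

Lemma separable_adjoin_sqrt K x : x ^+ 2 \in K -> separable_element K x.
Proof.
move=> Kx2; have [->|nzx] := eqVneq x 0; first exact/base_separable/rpred0.
apply/separable_elementP; exists (\prod_(y <- [:: x; - x]) ('X - y%:P)); split.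
- rewrite !big_cons big_nil mulr1.
  have -> : ('X - x%:P) * ('X - (- x)%:P) = 'X^2 - (x ^+ 2)%:P.
    by rewrite rmorphN rmorphXn /=; ring.
  by rewrite rpredB ?rpredX ?polyOverX // polyOverC.
- by rewrite root_prod_XsubC mem_head.
- by rewrite separable_prod_XsubC /= inE neq_opp.
Qed.

(** Degenerate steps are allowed, so a tower bounds the degree from above only; the lower bound
    comes from automorphisms, in [full_gal_moved_along]. *)
Fixpoint sqrt_tower (K : {vspace L}) (xs : seq L) : bool :=
  if xs is x :: xs' then (x ^+ 2 \in K) && sqrt_tower <<K; x>>%VS xs' else true.

Lemma dim_sqrt_tower K xs :
  sqrt_tower K xs -> (\dim <<K & xs>> <= 2 ^ size xs * \dim K)%N.
Proof.
elim: xs => [|x xs IHxs] /= in K *; first by rewrite Fadjoin_nil mul1n.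
case/andP=> Kx2 /IHxs; rewrite adjoin_cons => /leq_trans-> //.
rewrite expnSr -mulnA leq_mul2l dim_adjoin_sqrt //.
by case: ifP; rewrite ?leqnn ?orbT // leq_pmull ?orbT.
Qed.

Lemma separable_sqrt_tower K xs : sqrt_tower K xs -> separable K <<K & xs>>.
Proof.
elim: xs => [|x xs IHxs] /= in K *.
  by rewrite Fadjoin_nil separable_refl.
case/andP=> Kx2 /IHxs; rewrite adjoin_cons; apply: separable_trans.
by rewrite -adjoin_separable_eq separable_adjoin_sqrt.
Qed.

End SquareRootTowers.

(** A field built by successive adjunctions carries no normality over [F]. Its subfield generated by
    the full root list [rs] of a polynomial over [F] is a splitting field; [xs] is a shorter list of
    generators of the same subfield. *)
Lemma splitting_subfield (F : fieldType) (L : fieldExtType F) (xs rs : seq L) :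
    \prod_(z <- rs) ('X - z%:P) \is a polyOver 1%VS ->
    <<1 & rs>>%VS = <<1 & xs>>%VS ->
  exists (S : splittingFieldType F) (f : 'AHom(S, L)) (ys : seq S),
    map f ys = xs /\ <<1 & ys>>%VS = fullv.
Proof.
move=> prs Drs; pose E := <<1 & rs>>%AS; pose toL := linfun (vsval : subvs_of E -> L).
have lift zs : {subset zs <= E} -> exists ys, map toL ys = zs.
  move=> Ezs; exists (map (vsproj E) zs); rewrite -map_comp map_id_in // => y zsy.
  by rewrite /= lfunE /= vsprojK // Ezs.
have gen ys : <<1 & map toL ys>>%VS = E -> <<1 & ys>>%VS = fullv.
  move=> Dys; apply/vspaceP => u; rewrite memvf.
  have: val u \in (toL @: <<1 & ys>>)%VS.
    by rewrite aimg_adjoin_seq aimg1 Dys (valP u).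
  by case/memv_imgP=> v Lzs_v; rewrite lfunE => /val_inj->.
have [zs Dzs] := lift rs (@seqv_sub_adjoin _ _ _ _).
have ax : SplittingField.axiom (subvs_of E).
  exists (\prod_(z <- zs) ('X - z%:P)); last first.
    by exists zs; rewrite ?eqpxx // gen // Dzs.
  have := prs; rewrite -Dzs big_map => /polyOverP p1.
  apply/polyOverP => i; have /vlineP[k Dk] := p1 i.
  apply/vlineP; exists k; apply: val_inj; rewrite linearZ rmorph1 /= -Dk.
  have -> : \prod_(j <- zs) ('X - (toL j)%:P) =
            map_poly toL (\prod_(z <- zs) ('X - z%:P)).
    rewrite rmorph_prod; apply: eq_bigr => z _.
    by rewrite rmorphB /= map_polyX map_polyC.
  by rewrite coef_map /= lfunE.
pose S := HB.pack_for (splittingFieldType F) (subvs_of E)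
            (FieldExt_isSplittingField.Build F _ ax).
have [|ys Dys] := lift xs; first by rewrite /= Drs; apply: seqv_sub_adjoin.
by exists S, toL, ys; split=> //; apply: gen; rewrite Dys /= Drs.
Qed.

(** * The fields M and L *)

(* With [beta = p + q r] and [gamma = 1 - conj beta]: [s1, s2, t1, t2] are square
   roots of [beta], [conj beta], [gamma], [conj gamma]. *)
Definition five_roots (F : fieldType) (L : fieldExtType F) (a p q : F)
    (r s1 s2 t1 t2 : L) :=
  [/\ r ^+ 2 = a%:A, s1 ^+ 2 = p%:A + q%:A * r, s2 ^+ 2 = p%:A - q%:A * r,
      t1 ^+ 2 = 1 - s2 ^+ 2 & t2 ^+ 2 = 1 - s1 ^+ 2].

Section SplittingPolynomials.
Variables (F : fieldType) (L : fieldExtType F) (a p q : F) (r s1 s2 t1 t2 : L).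
Hypothesis eqs : five_roots a p q r s1 s2 t1 t2.

Let X1 : ('X : {poly L}) \is a polyOver 1%VS. Proof. exact: polyOverX. Qed.
Let C1 (k : F) : (k%:A : L)%:P \is a polyOver 1%VS.
Proof. by rewrite polyOverC; apply/vlineP; exists k. Qed.

(** The conjugation [r -> - r] exchanges the quadratic factors of [s1] and [s2], and those of [t1]
    and [t2], so the product involves [r] only through [r ^ 2 = a]. *)
Lemma polyOver_five_roots :
  \prod_(z <- [:: r; - r; s1; - s1; s2; - s2; t1; - t1; t2; - t2])
    ('X - z%:P) \is a polyOver (1%VS : {vspace L}).
Proof.
have [Dr Ds1 Ds2 Dt1 Dt2] := eqs.
have Er : r%:P ^+ 2 = (a%:A)%:P by rewrite -rmorphXn Dr.
have Es1 : s1%:P ^+ 2 = (p%:A)%:P + (q%:A)%:P * r%:P.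
  by rewrite -rmorphXn Ds1 rmorphD rmorphM.
have Es2 : s2%:P ^+ 2 = (p%:A)%:P - (q%:A)%:P * r%:P.
  by rewrite -rmorphXn Ds2 rmorphB rmorphM.
have Et1 : t1%:P ^+ 2 = 1 - s2%:P ^+ 2 by rewrite -!rmorphXn Dt1 rmorphB.
have Et2 : t2%:P ^+ 2 = 1 - s1%:P ^+ 2 by rewrite -!rmorphXn Dt2 rmorphB.
set A := (a%:A)%:P in Er; set P := (p%:A)%:P in Es1 Es2; set Q := (q%:A)%:P in Es1 Es2.
rewrite unlock /= !rmorphN /=.
set R := r%:P in Er Es1 Es2 *.
set S1 := s1%:P in Es1 Et2 *; set S2 := s2%:P in Es2 Et1 *.
set T1 := t1%:P in Et1 *; set T2 := t2%:P in Et2 *.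
have -> : ('X - R) * (('X - - R) * (('X - S1) * (('X - - S1) * (('X - S2) *
    (('X - - S2) * (('X - T1) * (('X - - T1) * (('X - T2) * (('X - - T2) * 1)))))))))
  = ('X ^+ 2 - R ^+ 2) * (('X ^+ 2 - S1 ^+ 2) * ('X ^+ 2 - S2 ^+ 2)) *
    (('X ^+ 2 - T1 ^+ 2) * ('X ^+ 2 - T2 ^+ 2)) by ring.
rewrite Et1 Et2 Es1 Es2.
have -> : ('X ^+ 2 - R ^+ 2) * (('X ^+ 2 - (P + Q * R)) * ('X ^+ 2 - (P - Q * R))) *
   (('X ^+ 2 - (1 - (P - Q * R))) * ('X ^+ 2 - (1 - (P + Q * R))))
  = ('X ^+ 2 - R ^+ 2) * (('X ^+ 2 - P) ^+ 2 - Q ^+ 2 * R ^+ 2) *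
    (('X ^+ 2 - 1 + P) ^+ 2 - Q ^+ 2 * R ^+ 2) by ring.
by rewrite Er !(rpredM, rpredB, rpredD, rpredX, rpred1, C1, X1).
Qed.

Variables (d : L).
Hypothesis nzc : t1 * t2 != 0.
Hypothesis Dd : d ^+ 2 = (1 + s1) * (1 + s2).

(** The eight elements are the square roots of the four radicands obtained from [(1 + s1) (1 + s2)]
    by changing the signs of [s1] and [s2]; thus all conjugates of [d] are rational in [d] and the
    five roots. *)
Lemma polyOver_sqrt_conjugates :
  \prod_(z <- [:: d; - d; d * (t2 / (1 + s1)); - (d * (t2 / (1 + s1)));
                 d * (t1 / (1 + s2)); - (d * (t1 / (1 + s2)));
                 d * (t1 * t2 / ((1 + s1) * (1 + s2)));
                 - (d * (t1 * t2 / ((1 + s1) * (1 + s2))))])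
    ('X - z%:P) \is a polyOver (1%VS : {vspace L}).
Proof.
have [Dr Ds1 Ds2 Dt1 Dt2] := eqs.
have /andP[nzt1 nzt2] : (t1 != 0) && (t2 != 0) by rewrite -negb_or -mulf_eq0.
have nz1 : 1 + s1 != 0.
  apply: contraNneq nzt2 => e; rewrite -sqrf_eq0 Dt2.
  have -> : 1 - s1 ^+ 2 = (1 + s1) * (1 - s1) by ring.
  by rewrite e mul0r.
have nz2 : 1 + s2 != 0.
  apply: contraNneq nzt1 => e; rewrite -sqrf_eq0 Dt1.
  have -> : 1 - s2 ^+ 2 = (1 + s2) * (1 - s2) by ring.
  by rewrite e mul0r.
set d2 := d * (t2 / _); set d3 := d * (t1 / (1 + s2)); set d4 := d * (_ / (_ * _)).
have Dd2 : d2 ^+ 2 = (1 - s1) * (1 + s2).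
  by rewrite /d2 !exprMn exprVn Dd Dt2; field; rewrite nz1.
have Dd3 : d3 ^+ 2 = (1 + s1) * (1 - s2).
  by rewrite /d3 !exprMn exprVn Dd Dt1; field; rewrite nz2.
have Dd4 : d4 ^+ 2 = (1 - s1) * (1 - s2).
  by rewrite /d4 !exprMn exprVn Dd exprMn Dt1 Dt2; field; rewrite nz1 nz2.
move: d2 d3 d4 Dd2 Dd3 Dd4 => d2 d3 d4 Dd2 Dd3 Dd4.
have Er : r%:P ^+ 2 = (a%:A)%:P by rewrite -rmorphXn Dr.
have Es1 : s1%:P ^+ 2 = (p%:A)%:P + (q%:A)%:P * r%:P.
  by rewrite -rmorphXn Ds1 rmorphD rmorphM.
have Es2 : s2%:P ^+ 2 = (p%:A)%:P - (q%:A)%:P * r%:P.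
  by rewrite -rmorphXn Ds2 rmorphB rmorphM.
have Ed1 : d%:P ^+ 2 = (1 + s1%:P) * (1 + s2%:P).
  by rewrite -rmorphXn Dd !(rmorphM, rmorphB, rmorphD, rmorph1).
have Ed2 : d2%:P ^+ 2 = (1 - s1%:P) * (1 + s2%:P).
  by rewrite -rmorphXn Dd2 !(rmorphM, rmorphB, rmorphD, rmorph1).
have Ed3 : d3%:P ^+ 2 = (1 + s1%:P) * (1 - s2%:P).
  by rewrite -rmorphXn Dd3 !(rmorphM, rmorphB, rmorphD, rmorph1).
have Ed4 : d4%:P ^+ 2 = (1 - s1%:P) * (1 - s2%:P).
  by rewrite -rmorphXn Dd4 !(rmorphM, rmorphB, rmorphD, rmorph1).
set A := (a%:A)%:P in Er; set P := (p%:A)%:P in Es1 Es2; set Q := (q%:A)%:P in Es1 Es2.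
rewrite unlock /= !rmorphN /=.
set R := r%:P in Er Es1 Es2 *.
set S1 := s1%:P in Es1 Ed1 Ed2 Ed3 Ed4 *; set S2 := s2%:P in Es2 Ed1 Ed2 Ed3 Ed4 *.
move: d%:P d2%:P d3%:P d4%:P Ed1 Ed2 Ed3 Ed4 => D1 D2 D3 D4 Ed1 Ed2 Ed3 Ed4.
have -> : ('X - D1) * (('X - - D1) * (('X - D2) * (('X - - D2) * (('X - D3) *
    (('X - - D3) * (('X - D4) * (('X - - D4) * 1)))))))
  = (('X ^+ 2 - D1 ^+ 2) * ('X ^+ 2 - D2 ^+ 2)) *
    (('X ^+ 2 - D3 ^+ 2) * ('X ^+ 2 - D4 ^+ 2)) by ring.
rewrite Ed1 Ed2 Ed3 Ed4.
(* The product is invariant under sign changes of [s1], [s2] and under their exchange, so it depends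
   only on the sum and the product of [Y1 = 1 - s1 ^ 2] and [Y2 = 1 - s2 ^ 2]; both lie in [F]. *)
pose T Y1 Y2 : {poly L} := 'X ^+ 8 - 4%:R * 'X ^+ 6 +
   (4%:R * (Y1 + Y2) - 2%:R * (Y1 * Y2)) * 'X ^+ 4 -
   4%:R * (Y1 * Y2) * 'X ^+ 2 + (Y1 * Y2) ^+ 2.
have -> : ('X^2 - (1 + S1) * (1 + S2)) * ('X^2 - (1 - S1) * (1 + S2)) *
   (('X^2 - (1 + S1) * (1 - S2)) * ('X^2 - (1 - S1) * (1 - S2)))
  = T (1 - S1 ^+ 2) (1 - S2 ^+ 2) by rewrite /T; ring.
rewrite Es1 Es2 /T.
have -> : 1 - (P + Q * R) + (1 - (P - Q * R)) = 2%:R * (1 - P) by ring.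
have -> : (1 - (P + Q * R)) * (1 - (P - Q * R)) = (1 - P) ^+ 2 - Q ^+ 2 * R ^+ 2 by ring.
by rewrite Er !(rpredM, rpredB, rpredD, rpredX, rpred1, rpred_nat, C1, X1).
Qed.

End SplittingPolynomials.

Section GaloisFields.
Variables (F : fieldType) (a p q : F).
Hypothesis char_ne2 : (2%:R : F) != 0.
Hypothesis nzc : (1 - p) ^+ 2 - a * q ^+ 2 != 0.

Lemma five_roots_norm (L : fieldExtType F) (r s1 s2 t1 t2 : L) :
  five_roots a p q r s1 s2 t1 t2 ->
  (s1 * s2) ^+ 2 = (p ^+ 2 - a * q ^+ 2)%:A /\
  (t1 * t2) ^+ 2 = ((1 - p) ^+ 2 - a * q ^+ 2)%:A.
Proof.
case=> Dr Ds1 Ds2 Dt1 Dt2; rewrite !exprMn Dt1 Dt2 Ds1 Ds2 -!in_algE.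
rewrite !(rmorphB, rmorphM, rmorphXn, rmorph1) /= -Dr.
by split; ring.
Qed.

Lemma five_roots_tower (L : fieldExtType F) (r s1 s2 t1 t2 : L) :
  five_roots a p q r s1 s2 t1 t2 ->
  sqrt_tower 1%VS [:: r; s1; s2; t1; t2].
Proof.
case=> Dr Ds1 Ds2 Dt1 Dt2 /=; rewrite Dr Ds1 Ds2 Dt1 Dt2.
set K0 := 1%AS : {subfield L}; set K1 := <<K0; r>>%AS; set K2 := <<K1; s1>>%AS.
set K3 := <<K2; s2>>%AS; set K4 := <<K3; t1>>%AS.
have k1 k : k%:A \in K1 by rewrite rpredZ // mem1v.
have r1 : r \in K1 by apply: memv_adjoin.
have K12 x : x \in K1 -> x \in K2 by apply: subvP_adjoin.
have K23 x : x \in K2 -> x \in K3 by apply: subvP_adjoin.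
have K34 x : x \in K3 -> x \in K4 by apply: subvP_adjoin.
have s1K : s1 ^+ 2 \in K1 by rewrite Ds1 rpredD // rpredM.
have s2K : s2 ^+ 2 \in K1 by rewrite Ds2 rpredB // rpredM.
rewrite -Ds1 -Ds2; apply/and5P; split.
- by rewrite rpredZ // mem1v.
- exact: s1K.
- exact: K12.
- by apply/K23/K12; rewrite -/K1 rpredB ?mem1v.
- by rewrite andbT; apply/K34/K23/K12; rewrite rpredB ?mem1v.
Qed.

Lemma six_roots_tower (L : fieldExtType F) (r s1 s2 t1 t2 d : L) :
    five_roots a p q r s1 s2 t1 t2 -> d ^+ 2 = (1 + s1) * (1 + s2) ->
  sqrt_tower 1%VS [:: r; s1; s2; t1; t2; d].
Proof.
move=> eqs Dd.
have := five_roots_tower eqs; rewrite /= => /and5P[-> -> -> -> /andP[-> _]] /=.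
pose E := <<1 & [:: r; s1; s2; t1; t2]>>%AS.
have E1 : 1 \in E := mem1v _.
have [Es1 Es2] : s1 \in E /\ s2 \in E.
  by split; apply: seqv_sub_adjoin; rewrite !inE eqxx ?orbT.
have : d ^+ 2 \in E by rewrite Dd rpredM // rpredD.
by rewrite /E /= !adjoin_cons adjoin_nil subfield_closed => ->.
Qed.

Lemma five_roots_ahom (L L' : fieldExtType F) (f : 'AHom(L, L')) (r s1 s2 t1 t2 : L) :
  five_roots a p q (f r) (f s1) (f s2) (f t1) (f t2) ->
  five_roots a p q r s1 s2 t1 t2.
Proof.
case; rewrite -!rmorphXn -(rmorph1 f) -![_ *: f _]linearZ -!rmorphM.
rewrite -rmorphD -!rmorphB.
by move=> /fmorph_inj ? /fmorph_inj ? /fmorph_inj ? /fmorph_inj ? /fmorph_inj ?.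
Qed.

Lemma galois_sqrt_tower (L : splittingFieldType F) (xs : seq L) :
  sqrt_tower 1%VS xs -> <<1 & xs>>%VS = fullv ->
  galois (1%VS : {vspace L}) fullv.
Proof.
move=> txs Dxs; apply/and3P; split; rewrite ?subvf ?normalFieldf // -Dxs.
exact: separable_sqrt_tower.
Qed.

Lemma five_roots_field :
  exists (L : splittingFieldType F) (r s1 s2 t1 t2 : L),
    [/\ five_roots a p q r s1 s2 t1 t2, <<1 & [:: r; s1; s2; t1; t2]>>%VS = fullv
      & galois (1%VS : {vspace L}) fullv].
Proof.
have [L0 [r [s1 [s2 [t1 [t2 [d [eqs _]]]]]]]] := tower_exists a p q.
have := polyOver_five_roots eqs.
move/(@splitting_subfield _ _ [:: r; s1; s2; t1; t2]) => [].
  apply/eqP; rewrite eqEsubv; apply/andP.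
  have mem x : x \in [:: r; s1; s2; t1; t2] -> x \in <<1 & [:: r; s1; s2; t1; t2]>>%VS.
    exact: seqv_sub_adjoin.
  split; apply/Fadjoin_seqP; split; rewrite ?sub1v //.
    move=> x; rewrite !inE => /or3P[|| /or3P[|| /or3P[|| /or3P[|| /orP[]]]]] /eqP->;
    by rewrite ?rpredN mem // !inE eqxx ?orbT.
  move=> x; rewrite !inE => /or4P[||| /orP[]] /eqP->;
  by apply: seqv_sub_adjoin; rewrite !inE eqxx ?orbT.
move=> L [f [[|r' [|s1' [|s2' [|t1' [|t2' [|? ?]]]]]] [//= [Er Es1 Es2 Et1 Et2] gen]]].
have eqs' : five_roots a p q r' s1' s2' t1' t2'.
  by apply: (@five_roots_ahom _ _ f); rewrite Er Es1 Es2 Et1 Et2.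
exists L, r', s1', s2', t1', t2'; split=> //.
exact: galois_sqrt_tower (five_roots_tower eqs') gen.
Qed.

Lemma six_roots_field :
  exists (L : splittingFieldType F) (r s1 s2 t1 t2 d : L),
    [/\ five_roots a p q r s1 s2 t1 t2, d ^+ 2 = (1 + s1) * (1 + s2),
        <<1 & [:: r; s1; s2; t1; t2; d]>>%VS = fullv
      & galois (1%VS : {vspace L}) fullv].
Proof.
have [L0 [r [s1 [s2 [t1 [t2 [d [eqs Dd]]]]]]]] := tower_exists a p q.
have nzt : t1 * t2 != 0.
  have [_ e] := five_roots_norm eqs.
  by rewrite -sqrf_eq0 e scaler_eq0 negb_or nzc oner_neq0.
have := rpredM (polyOver_five_roots eqs) (polyOver_sqrt_conjugates eqs nzt Dd).
rewrite -big_cat.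
move/(@splitting_subfield _ _ [:: r; s1; s2; t1; t2; d]) => [].
  apply/eqP; rewrite eqEsubv; apply/andP.
  set E := <<1 & [:: r; s1; s2; t1; t2; d]>>%AS.
  have mem x : x \in [:: r; s1; s2; t1; t2; d] -> x \in E.
    exact: seqv_sub_adjoin.
  have [E1 Er Es1 Es2] : [/\ 1 \in E, r \in E, s1 \in E & s2 \in E].
    by split; [apply: mem1v | | |]; apply: mem; rewrite !inE eqxx ?orbT.
  have [Et1 Et2 Ed] : [/\ t1 \in E, t2 \in E & d \in E].
    by split; apply: mem; rewrite !inE eqxx ?orbT.
  have [E1s1 E1s2] : 1 + s1 \in E /\ 1 + s2 \in E by rewrite !rpredD.
  split; apply/Fadjoin_seqP; split; rewrite ?sub1v //.
    move=> x; rewrite mem_cat !inE => /orP[/or3P[|| /or3P[|| /or3P[|| /or3P[|| /orP[]]]]]|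
      /or4P[||| /or4P[||| /orP[]]]] /eqP->;
    by rewrite ?rpredN // rpredM // rpred_div // rpredM.
  move=> x; rewrite !inE => /or4P[||| /or3P[]] /eqP->;
  by apply: seqv_sub_adjoin; rewrite !inE eqxx ?orbT.
move=> L [f [[|r' [|s1' [|s2' [|t1' [|t2' [|d' [|? ?]]]]]]] []]] //=.
case=> Er Es1 Es2 Et1 Et2 Ed gen.
have eqs' : five_roots a p q r' s1' s2' t1' t2'.
  by apply: (@five_roots_ahom _ _ f); rewrite Er Es1 Es2 Et1 Et2.
have Dd' : d' ^+ 2 = (1 + s1') * (1 + s2').
  by apply: (fmorph_inj f); rewrite rmorphXn rmorphM !rmorphD rmorph1 /= Ed Es1 Es2.
exists L, r', s1', s2', t1', t2', d'; split=> //.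
exact: galois_sqrt_tower (six_roots_tower eqs' Dd') gen.
Qed.
End GaloisFields.

(** * Galois groups of square root towers *)

Lemma sqrt_in_base (F : fieldType) (L : fieldExtType F) (x : L) (k : F) :
  k != 0 -> x ^+ 2 = k%:A -> x \in (1%VS : {vspace L}) -> nz_square k.
Proof.
move=> nzk Dx /vlineP[y Dy]; have Dk : k = y ^+ 2.
  by apply: (fmorph_inj (in_alg L)); rewrite rmorphXn /= -Dx -Dy.
by exists y; split=> //; apply: contraNneq nzk => z; rewrite Dk z expr0n.
Qed.

(** If a root lay in the field generated by the preceding ones, [adjoin_sqrt_kummer] would peel off
    these roots one at a time and leave a monomial in the roots lying in [F], whose square is an
    excluded square class. *)
Lemma indep_sqrt_tower (F : fieldType) (L : fieldExtType F) (a b c : F) (x y z : L) :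
    (2%:R : F) != 0 -> [/\ a != 0, b != 0 & c != 0] -> indep_mod_sq3 a b c ->
    x ^+ 2 = a%:A -> y ^+ 2 = b%:A -> z ^+ 2 = c%:A ->
  [/\ x \notin (1%VS : {vspace L}), y \notin <<1; x>>%VS & z \notin <<<<1; x>>; y>>%VS].
Proof.
move=> ch2 [nza nzb nzc] ind Dx Dy Dz.
have alg1 k : k%:A \in (1%AS : {subfield L}) by rewrite rpredZ ?mem1v.
have no (e1 e2 e3 : bool) : [|| e1, e2 | e3] ->
    x ^+ e1 * y ^+ e2 * z ^+ e3 \notin (1%VS : {vspace L}).
  move=> e; apply/negP => in1; apply: (ind e1 e2 e3 e); apply: sqrt_in_base in1.
    by rewrite !mulf_neq0 ?expf_neq0.
  rewrite !exprMn -!exprM !(mulnC _ 2%N) !exprM Dx Dy Dz -!in_algE.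
  by rewrite !rmorphM !rmorphXn.
have x1 : x \notin (1%AS : {subfield L}).
  by have := no true false false isT; rewrite !mulr1.
have x2 : x ^+ 2 \in (1%AS : {subfield L}) by rewrite Dx.
have y2 : y ^+ 2 \in (1%AS : {subfield L}) by rewrite Dy.
have z2 : z ^+ 2 \in (1%AS : {subfield L}) by rewrite Dz.
have sq u v : u ^+ 2 \in (1%AS : {subfield L}) -> v ^+ 2 \in (1%AS : {subfield L}) ->
    (u * v) ^+ 2 \in (1%AS : {subfield L}).
  by rewrite exprMn; apply: rpredM.
have kum := adjoin_sqrt_kummer ch2 x2.
split=> //; apply/negP.
  case/(kum _ y2) => [|]; apply/negP.
    by have := no false true false isT; rewrite mul1r mulr1.
  by have := no true true false isT; rewrite mulr1 mulrC.
have up u : u \in (1%AS : {subfield L}) -> u \in <<1%AS; x>>%AS.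
  exact: subvP_adjoin.
case/(adjoin_sqrt_kummer ch2 (up _ y2) (up _ z2)) => [/(kum _ z2)|/(kum _ (sq _ _ z2 y2))] [];
  apply/negP.
- by have := no false false true isT; rewrite !mul1r.
- by have := no true false true isT; rewrite mulr1 mulrC.
- by have := no false true true isT; rewrite mul1r mulrC.
- by have := no true true true isT; rewrite -mulrA mulrC (mulrC z).
Qed.

Section GaloisActions.
Variables (F : fieldType) (L : splittingFieldType F).
Hypothesis char_ne2 : (2%:R : F) != 0.
Hypothesis galL : galois (1%VS : {vspace L}) fullv.
Local Notation gal := (gal_of (fullv : {vspace L})).
Implicit Types (K : {subfield L}) (s t : gal) (x y : L).

Lemma gal_mul s t x : (s * t)%g x = t (s x). Proof. exact/galM/memvf. Qed.

Lemma mem_gal1 s : s \in 'Gal({:L} / 1)%g.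
Proof. by rewrite gal_kHom ?sub1v // k1AHom. Qed.

Lemma gal_adjoin K s x :
  s \in 'Gal({:L} / K)%g -> s x = x -> s \in 'Gal({:L} / <<K; x>>)%g.
Proof.
move=> Ks sx; rewrite gal_kHom ?subvf //; apply/kAHomP => y /Fadjoin_polyP[p Kp ->].
by rewrite -horner_map /= (fixedPoly_gal (subvf K) Ks Kp) sx.
Qed.

Lemma gal_adjoin_seq K s xs :
  s \in 'Gal({:L} / K)%g -> {in xs, forall x, s x = x} -> s \in 'Gal({:L} / <<K & xs>>)%g.
Proof.
elim: xs K => [|x xs IHxs] K Ks sxs; first by rewrite Fadjoin_nil.
rewrite adjoin_cons; apply: IHxs => [|y xsy]; last by rewrite sxs // inE xsy orbT.
by apply: gal_adjoin => //; rewrite sxs ?mem_head.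
Qed.

Lemma gal_eq_gen xs s t :
  <<1 & xs>>%VS = {:L}%VS -> {in xs, s =1 t} -> s = t.
Proof.
move=> gen st; apply/eqP; rewrite eq_mulgV1; apply/gal_eqP => y _.
have fix_xs : (s * t^-1)%g \in 'Gal({:L} / <<1 & xs>>)%g.
  apply: gal_adjoin_seq => [|x xsx]; first exact: mem_gal1.
  by rewrite gal_mul st // -gal_mul mulgV gal_id.
rewrite gal_id; apply: fixed_gal fix_xs _; first exact: subvf.
by rewrite /= gen memvf.
Qed.

Lemma exists_gal_neg K x :
  x ^+ 2 \in K -> x \notin K -> exists2 s, s \in 'Gal({:L} / K)%g & s x = - x.
Proof.
move=> Kx2 K'x; have galK : galois K {:L} by apply: galoisS galL; rewrite sub1v subvf.
have [s Ks sx] : exists2 s, s \in 'Gal({:L} / K)%g & s x != x.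
  apply/exists_inP; apply: contraNT K'x => /exists_inPn nos.
  rewrite -(galois_fixedField galK); apply/fixedFieldP; rewrite ?memvf // => s Ks.
  by have := nos s Ks; rewrite negbK => /eqP.
exists s => //; have : s x ^+ 2 == x ^+ 2.
  by rewrite -rmorphXn /= (fixed_gal (subvf K) Ks).
by rewrite eqf_sqr (negPf sx) => /eqP.
Qed.

(* [H] contains witnesses showing that the stabilizers of ever longer prefixes
   of [xs] decrease strictly, so each step at least halves the order. *)
Fixpoint moved_along (H : {set gal}) (K : {vspace L}) (xs : seq L) : Prop :=
  if xs is x :: xs' then
    (exists s, [/\ s \in H, s \in 'Gal({:L} / K)%g & s x != x]) /\
    moved_along H <<K; x>>%VS xs'
  else True.

Lemma card_moved_along (H : {group gal}) K xs :
  moved_along H K xs -> (2 ^ size xs <= #|(H :&: 'Gal({:L} / K))%g|)%N.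
Proof.
elim: xs K => [|x xs IHxs] K /=; first by rewrite cardG_gt0.
case=> [[s [Hs Ks sx]] /IHxs]; rewrite expnS => le_xs.
set G1 := [group of (H :&: 'Gal({:L} / K))%g].
set G2 := [group of (H :&: 'Gal({:L} / <<K; x>>))%g].
have sG21 : G2 \subset G1 by rewrite setIS // galS // subv_adjoin.
apply: (@leq_trans (#|G1 : G2|%g * #|G2|)%N); last by rewrite mulnC Lagrange.
apply: leq_mul => //; rewrite indexg_gt1; apply/subsetPn; exists s; first by rewrite inE Hs.
rewrite inE Hs /=; apply: contraNN sx => /(fixed_gal (subvf _))-> //.
exact: memv_adjoin.
Qed.

(** Squeeze: the tower bounds the degree by [2 ^ size xs], and [H] already has that many
    elements. *)
Lemma full_gal_moved_along (H : {group gal}) xs :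
    sqrt_tower 1%VS xs -> <<1 & xs>>%VS = {:L}%VS -> moved_along H 1%VS xs ->
  H :=: 'Gal({:L} / 1)%g /\ #|H| = (2 ^ size xs)%N.
Proof.
move=> txs gen /card_moved_along leH.
have sHG : H \subset 'Gal({:L} / 1)%g by apply/subsetP => s _; apply: mem_gal1.
have := dim_sqrt_tower txs; rewrite gen dimv1 muln1 => ledim.
have cG : #|'Gal({:L} / 1)%g| = \dim {:L} by rewrite -(galois_dim galL) dimv1 divn1.
move: leH; rewrite (setIidPl sHG) => leH.
have eHG : H :=: 'Gal({:L} / 1)%g.
  by apply/eqP; rewrite eqEcard sHG cG (leq_trans ledim).
split=> //.
by apply/eqP; rewrite eqn_leq leH andbT eHG cG.
Qed.

End GaloisActions.

(** * The groups DwedgeD and G2 *)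

Local Open Scope group_scope.

Definition G2_relations (gT : finGroupType) (x y z : gT) : Prop :=
  [/\ x ^+ 2 = 1, y ^+ 2 = 1, z ^+ 2 = 1, [~ x, y] ^+ 2 = 1 & [~ x, z] ^+ 2 = 1] /\
  [/\ [~ y, z] = 1, [~ y, [~ x, z]] = [~ z, [~ x, y]], [~ y, [~ x, z]] ^+ 2 = 1,
      [~ [~ y, [~ x, z]], x] = 1 &
      [~ [~ y, [~ x, z]], y] = 1 /\ [~ [~ y, [~ x, z]], z] = 1].

Definition gen3 (gT : finGroupType) (x y z : gT) := <[x]> <*> <[y]> <*> <[z]>.

Section ThreeGenerators.
Import Presentation.

(** [rel] merges all equations of a presentation into one equality of nested tuples; here they form
    a plain conjunction, which can be destructed relation by relation. *)
Fixpoint holds (gT : finGroupType) (e : seq gT) (f : formula) : bool :=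
  match f with
  | Eq2 s t => eval e s == eval e t
  | And f1 f2 => holds e f1 && holds e f2
  end.

Lemma relE (gT : finGroupType) (e : seq gT) f r : rel e f r = holds e f && r :> bool.
Proof.
elim: f r => [s t|f1 IH1 f2 IH2] r /=; last by rewrite IH1 IH2 andbA.
by case: r => [|vT v1 v2] /=; rewrite ?andbT.
Qed.

Lemma hom_gen3 (gT : finGroupType) (G : {set gT}) (f : term -> term -> term -> formula) :
  hom G (fun x => Generator (fun y => Generator (fun z => Formula (f x y z)))) =
  [exists v : gT * gT * gT, (gen3 v.1.1 v.1.2 v.2 == G) &&
     holds [:: v.1.1; v.1.2; v.2] (f (Cst 0) (Cst 1) (Cst 2))].
Proof.
apply: eq_existsb => -[[x y] z] /=.
by rewrite -[holds _ _]andbT -(relE _ _ NoRel); case: rel => [|vT v1 v2] /=; rewrite ?andbT.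
Qed.

End ThreeGenerators.

Lemma G2_homGrpP (gT : finGroupType) (G : {group gT}) :
  reflect (exists x y z, G2_relations x y z /\ gen3 x y z = G)
    (G \homg Grp (x : y : z :
    x ^+ 2, y ^+ 2, z ^+ 2, [~ x, y] ^+ 2, [~ x, z] ^+ 2, [~ y, z],
    [~ y, [~ x, z]] = [~ z, [~ x, y]],
    [~ y, [~ x, z]] ^+ 2,
    [~ [~ y, [~ x, z]], x], [~ [~ y, [~ x, z]], y], [~ [~ y, [~ x, z]], z])).
Proof.
rewrite /Presentation.Cast hom_gen3; apply: (iffP existsP) => [[[[x y] z]] | [x [y [z []]]]].
  case/andP=> /eqP DG /=.
  case/and5P=> /eqP rx /eqP ry /eqP rz /eqP rxy /and5P[/eqP rxz /eqP ryz /eqP rw /eqP rww].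
  by case/and3P=> /eqP rwx /eqP rwy /eqP rwz; exists x, y, z.
case=> -[rx ry rz rxy rxz] [ryz rw rww rwx [rwy rwz]] DG; exists (x, y, z) => /=.
by rewrite DG rx ry rz rxy rxz ryz -rw rww rwx rwy rwz !eqxx.
Qed.

Canonical gen3_group (gT : finGroupType) (x y z : gT) := Eval hnf in [group of gen3 x y z].

Lemma gen3_sub (gT : finGroupType) (x y z : gT) (A : {group gT}) :
  (gen3 x y z \subset A) = [&& x \in A, y \in A & z \in A].
Proof. by rewrite !join_subG !cycle_subG andbA. Qed.

Lemma mem_gen3 (gT : finGroupType) (x y z : gT) :
  [/\ x \in gen3 x y z, y \in gen3 x y z & z \in gen3 x y z].
Proof. by apply/and3P; rewrite -(@gen3_sub _ x y z [group of gen3 x y z]). Qed.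

Lemma involution_inv (gT : finGroupType) (t : gT) : t ^+ 2 = 1 -> t^-1 = t.
Proof. by rewrite expgS expg1 => /eqP; rewrite -eq_invg_mul => /eqP. Qed.

(** For an involution [v] the commutator is [v ^ u * v], and a product of two involutions squares to
    1 only if they commute. *)
Lemma commute_involution_conj (gT : finGroupType) (u v : gT) :
  u ^+ 2 = 1 -> v ^+ 2 = 1 -> [~ u, v] ^+ 2 = 1 -> v ^ (v ^ u) = v.
Proof.
move=> u2 v2 /involution_inv.
rewrite commgEr invMg -conjVg invgK (involution_inv v2) => e.
exact/conjg_fixP/commgP.
Qed.

Lemma card_join_involution (gT : finGroupType) (A : {group gT}) (t : gT) :
  t ^+ 2 = 1 -> t \in 'N(A) -> (#|A <*> <[t]>| <= 2 * #|A|)%N.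
Proof.
move=> t2 nAt; rewrite norm_joinEr ?cycle_subG //.
apply: (@leq_trans (#|A| * #|<[t]>|)%N); first by rewrite mul_cardG leq_pmulr ?cardG_gt0.
by rewrite mulnC leq_mul // -orderE dvdn_leq // order_dvdn t2.
Qed.

Lemma norm_join_cycle (gT : finGroupType) (A : {group gT}) (s t : gT) :
  t \in 'N(A) -> s ^ t \in A <*> <[s]> -> t \in 'N(A <*> <[s]>).
Proof.
move=> nAt st; rewrite inE /= -genJ conjUg -cycleJ gen_subG subUset (normP nAt).
by rewrite joing_subl cycle_subG.
Qed.

Section G2Relations.
Variables (gT : finGroupType) (x y z : gT).
Hypothesis rels : G2_relations x y z.
Let w := [~ y, [~ x, z]].

(** The involutions [y], [z], [y ^ x], [z ^ x], [x] are adjoined to [<[w]>] in this order. Each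
    normalizes the group reached before it, since conjugation changes the earlier generators at most
    by a factor [w] until [x] exchanges [y] with [y ^ x] and [z] with [z ^ x]. Five doublings give
    32; the order of [w] is kept open, being 1 for DwedgeD and at most 2 for G2. *)
Lemma card_G2_relations : (#|gen3 x y z| <= 32 * #[w])%N.
Proof.
case: rels => -[x2 y2 z2 xy2 xz2] [yz ew w2 wx [wy wz]].
have cw (s t : gT) : [~ s, t] = 1 -> s ^ t = s by move/eqP => c; apply/conjg_fixP.
have [Wx Wy Wz] : [/\ w ^ x = w, w ^ y = w & w ^ z = w] by split; apply: cw.
have Yz : y ^ z = y by apply: cw.
have Zy : z ^ y = z by apply: cw; rewrite -invg_comm yz invg1.
have fixV (s t : gT) : s ^ t = s -> s ^ (t^-1) = s.
  by move=> e; rewrite -{1}e -conjgM mulgV conjg1.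
have fixJ (s t u : gT) : s ^ u = s -> s ^ t = s -> s ^ (t ^ u) = s.
  by move=> su st; rewrite [t ^ u]conjgE !conjgM (fixV _ _ su) st su.
have Yyx := commute_involution_conj x2 y2 xy2.
have Zzx := commute_involution_conj x2 z2 xz2.
have commE (t : gT) : t ^+ 2 = 1 -> [~ x, t] = t ^ x * t.
  by move=> t2; rewrite commgEr (involution_inv t2).
(* By the relation [ew] the same [w] measures the failure to commute of two pairs: [y] with [z ^ x]
   here, [z] with [y ^ x] next. *)
have Yzx : y ^ (z ^ x) = y * w.
  have : y ^ [~ x, z] = y * w by rewrite /w commgEl mulKVg.
  by rewrite commE // conjgM => e; apply: (conjg_inj z); rewrite e conjMg Yz Wz.
have Zyx : z ^ (y ^ x) = z * w.
  have : z ^ [~ x, y] = z * w by rewrite /w ew commgEl mulKVg.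
  by rewrite commE // conjgM => e; apply: (conjg_inj y); rewrite e conjMg Zy Wy.
have in1 (A : {group gT}) (t : gT) : t \in A <*> <[t]>.
  by rewrite -cycle_subG joing_subr.
have inJ (A : {group gT}) (s t : gT) : t \in A -> t \in A <*> <[s]>.
  by move=> At; rewrite (subsetP (joing_subl _ _)).
pose A1 := <[w]>%G; pose A2 := (A1 <*> <[y]>)%G; pose A3 := (A2 <*> <[z]>)%G.
pose A4 := (A3 <*> <[y ^ x]>)%G; pose A5 := (A4 <*> <[z ^ x]>)%G; pose A6 := (A5 <*> <[x]>)%G.
have w1 : w \in A1 by apply: cycle_id.
have N1 t : w ^ t = w -> t \in 'N(A1).
  by move=> e; rewrite inE -cycleJ e.
have wA2 : w \in A2 := inJ _ _ _ w1.
have yJ2 : (y ^ x) ^+ 2 = 1 by rewrite -conjXg y2 conj1g.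
have zJ2 : (z ^ x) ^+ 2 = 1 by rewrite -conjXg z2 conj1g.
have C2 : (#|A2| <= 2 * #|A1|)%N by apply/card_join_involution/N1.
have C3 : (#|A3| <= 2 * #|A2|)%N.
  apply: card_join_involution => //; apply: norm_join_cycle; first exact: N1.
  by rewrite Yz in1.
have C4 : (#|A4| <= 2 * #|A3|)%N.
  apply: card_join_involution => //; apply: norm_join_cycle; first apply: norm_join_cycle.
  - exact/N1/fixJ.
  - by rewrite Yyx in1.
  - by rewrite Zyx groupM ?in1 //; apply: inJ.
have C5 : (#|A5| <= 2 * #|A4|)%N.
  apply: card_join_involution => //; apply: norm_join_cycle; first apply: norm_join_cycle;
    first apply: norm_join_cycle.
  - exact/N1/fixJ.
  - by rewrite Yzx groupM ?in1 //; apply: inJ.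
  - by rewrite Zzx in1.
  - by rewrite -conjJg Yz in1.
have xx : x * x = 1 by rewrite -x2.
have C6 : (#|A6| <= 2 * #|A5|)%N.
  apply: card_join_involution => //.
  have sub (A B : {group gT}) (s : gT) :
      A :^ x \subset B -> s ^ x \in B -> (A <*> <[s]>) :^ x \subset B.
    by move=> AB sB; rewrite -genJ conjUg -cycleJ gen_subG subUset AB cycle_subG.
  rewrite inE; apply: (sub A4); first apply: (sub A3); first apply: (sub A2);
    first apply: (sub A1).
  - by rewrite -cycleJ Wx cycle_subG; do 4!apply: (inJ).
  - by apply: (inJ); apply: in1.
  - exact: in1.
  - by rewrite -conjgM xx conjg1; do 3!apply: (inJ); apply: in1.
  - by rewrite -conjgM xx conjg1; do 2!apply: (inJ); apply: in1.
apply: (@leq_trans #|A6|).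
  apply: subset_leq_card; rewrite gen3_sub in1 /=.
  apply/andP; split.
    by apply: (inJ A5); apply: (inJ A4); apply: (inJ A3); apply: (inJ A2); apply: in1.
  by apply: (inJ A5); apply: (inJ A4); apply: (inJ A3); apply: in1.
have -> : (32 * #[w] = 2 * (2 * (2 * (2 * (2 * #|A1|)))))%N by rewrite !mulnA.
apply: (leq_trans C6); rewrite leq_mul2l; apply: (leq_trans C5).
rewrite leq_mul2l; apply: (leq_trans C4); rewrite leq_mul2l; apply: (leq_trans C3).
by rewrite leq_mul2l.
Qed.
End G2Relations.

Lemma G2_relations_pair (gT hT : finGroupType) (x y z : gT) (x' y' z' : hT) :
  G2_relations x y z -> G2_relations x' y' z' -> G2_relations (x, x') (y, y') (z, z').
Proof.
case=> -[rx ry rz rxy rxz] [ryz rw rww rwx [rwy rwz]].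
case=> -[sx sy sz sxy sxz] [syz sw sww swx [swy swz]].
have pR (g g' : gT) (h h' : hT) : [~ (g, h), (g', h')] = ([~ g, g'], [~ h, h']) by [].
have p2 (g : gT) (h : hT) : (g, h) ^+ 2 = (g ^+ 2, h ^+ 2) by [].
split; split; rewrite ?pR ?p2 ?rx ?ry ?rz ?rxy ?rxz ?ryz ?rww ?rwx //;
  rewrite ?sx ?sy ?sz ?sxy ?sxz ?syz ?sww ?swx //.
  by rewrite rw sw.
by rewrite rwy rwz swy swz.
Qed.

(* The subgroup generated by the pairs projects onto both groups, and by
   cardinality its first projection is an isomorphism. *)
Lemma gen3_homg (gT hT : finGroupType) (x y z : gT) (x' y' z' : hT) :
    (#|gen3 (x, x') (y, y') (z, z')| <= #|gen3 x y z|)%N ->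
  gen3 x' y' z' \homg gen3 x y z.
Proof.
set K := gen3 _ _ _ => leK.
have im (aT : finGroupType) (f : {morphism [set: (gT * hT)%type] >-> aT}) u v w :
    f @* gen3 u v w = gen3 (f u) (f v) (f w).
  by rewrite !morphimY ?subsetT // !morphim_cycle ?inE.
have D1 : fst_morphism gT hT @* K = gen3 x y z by apply: im.
have D2 : snd_morphism gT hT @* K = gen3 x' y' z' by apply: im.
have iso1 : gen3 x y z \isog K.
  by rewrite isogEcard leK andbT /= -D1 morphim_homg ?subsetT.
rewrite -D2; apply: homg_trans (morphim_homg _ (subsetT _)) _.
by apply: isog_hom; rewrite isog_sym.
Qed.

(** Order 64 is the largest that the relations permit. Pairing the generators with any other
    solution gives a solution again, whose group is therefore no larger, and [gen3_homg] provides
    the universal property. *)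
Lemma G2_isoGrp (gT : finGroupType) (x y z : gT) :
  G2_relations x y z -> #|gen3 x y z| = 64 -> isog_G2 (gen3 x y z).
Proof.
move=> rel card; apply: intro_isoGrp; first by apply/G2_homGrpP; exists x, y, z.
move=> rT H /G2_homGrpP[x' [y' [z' [rel' <-]]]]; apply: gen3_homg.
have rels := G2_relations_pair rel rel'; apply: leq_trans (card_G2_relations rels) _.
rewrite card (@leq_mul 32 _ 32 2) // dvdn_leq // order_dvdn.
by case: rels => _ [_ _ -> _ _].
Qed.

Lemma gen3_isog (gT hT : finGroupType) (x y z : gT) (x' y' z' : hT) :
    G2_relations x y z -> [~ y, [~ x, z]] = 1 -> #|gen3 x y z| = 32 ->
    G2_relations x' y' z' -> [~ y', [~ x', z']] = 1 -> #|gen3 x' y' z'| = 32 ->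
  gen3 x y z \isog gen3 x' y' z'.
Proof.
move=> rel w1 card rel' w1' card'; rewrite isog_sym isogEcard card card' leqnn andbT.
apply: gen3_homg; apply: leq_trans (card_G2_relations (G2_relations_pair rel rel')) _.
have -> : [~ (y, y'), [~ (x, x'), (z, z')]] = 1.
  by rewrite -[LHS]/([~ y, [~ x, z]], [~ y', [~ x', z']]) w1 w1'.
by rewrite order1 card.
Qed.

Lemma index2_mul (gT : finGroupType) (G V : {group gT}) (x y : gT) :
    V \subset G -> #|G| = (2 * #|V|)%N -> x \in G :\: V -> y \in G :\: V ->
  x * y \in V.
Proof.
move=> sVG cG /setDP[Gx V'x] GVy.
suff DV : x^-1 *: V = G :\: V by move: GVy; rewrite -DV mem_lcoset invgK.
apply/eqP; rewrite eqEcard card_lcoset cardsD (setIidPr sVG) cG mul2n -addnn addnK leqnn.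
rewrite andbT; apply/subsetP => g /lcosetP[v Vv ->]; rewrite inE groupMr ?groupV // V'x.
by rewrite groupM ?groupV // (subsetP sVG).
Qed.

(** * The dihedral group of order 8, its Klein subgroups and the pullback *)

Lemma D8_generators :
  exists x v : 'D_8, [/\ x ^+ 2 = 1, v ^+ 2 = 1, (x * v) ^+ 4 = 1 &
                         <[x]> <*> <[v]> = [set: 'D_8]].
Proof.
have := @Grp'_dihedral 4 isT => /isoGrp_hom/existsP[[x v]] /=.
by rewrite !xpair_eqE => /and4P[/eqP DG /eqP x2 /eqP v2 /eqP xv]; exists x, v.
Qed.

Lemma card_D8 : #|[set: 'D_8]| = 8.
Proof. exact: (@card_dihedral 4 isT). Qed.

Section KleinSubgroup.
Variables (x v : 'D_8).
Hypotheses (x2 : x ^+ 2 = 1) (v2 : v ^+ 2 = 1) (xv4 : (x * v) ^+ 4 = 1).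
Hypothesis gen : <[x]> <*> <[v]> = [set: 'D_8].
Let V := (<[v]> <*> <[v ^ x]>)%G.

Lemma D8_comm2 : [~ x, v] ^+ 2 = 1.
Proof.
have -> : [~ x, v] = (x * v) ^+ 2.
  by rewrite commgEl conjgE !involution_inv // !expgS expg0 mulg1 !mulgA.
by rewrite -expgM.
Qed.

Lemma D8_klein_normal : x \in 'N(V).
Proof.
rewrite inE /= -genJ conjUg -!cycleJ gen_subG subUset !cycle_subG.
by rewrite -conjgM -expg2 x2 conjg1 -!cycle_subG joing_subl joing_subr.
Qed.

Lemma D8_klein_abelian : abelian V.
Proof.
rewrite abelianY !cycle_abelian /= cent_cycle cycle_subG.
exact/cent1P/commute_sym/commgP/conjg_fixP/(commute_involution_conj x2 v2 D8_comm2).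
Qed.

(** Two commuting involutions give at most four elements; fewer are impossible, as adjoining [x] at
    most doubles [V] and must reach eight. *)
Lemma card_D8_klein : #|V| = 4 /\ [set: 'D_8] = V <*> <[x]>.
Proof.
have DG : [set: 'D_8] = V <*> <[x]>.
  apply/eqP; rewrite eqEsubset subsetT andbT -gen join_subG joing_subr /=.
  by rewrite -joingA joing_subl.
split=> //; apply/eqP; rewrite eqn_leq; apply/andP; split.
  have nvx : v ^ x \in 'N(<[v]>%G).
    have := D8_klein_abelian; rewrite abelianY => /and3P[_ _]; rewrite cycle_subG.
    exact: (subsetP (cent_sub _)).
  have vx2 : (v ^ x) ^+ 2 = 1 by rewrite -conjXg v2 conj1g.
  apply: leq_trans (card_join_involution vx2 nvx) _.
  by rewrite (@leq_mul 2 _ 2 2) // dvdn_leq // order_dvdn v2.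
have := card_join_involution x2 D8_klein_normal; rewrite -DG card_D8.
by case: #|_| => [|[|[|[|]]]].
Qed.
End KleinSubgroup.

Lemma D8_nonabelian : ~~ abelian [set: 'D_8].
Proof.
apply/negP => /centsP aD; have [x [v [x2 v2 xv4 gen]]] := D8_generators.
have [cV _] := card_D8_klein x2 v2 xv4 gen.
have := cV; rewrite /= (_ : v ^ x = v); last first.
  by apply/conjg_fixP/commgP/aD; rewrite inE.
rewrite joingE setUid genGid => c4; have : (#[v] <= 2)%N by rewrite dvdn_leq // order_dvdn v2.
by rewrite orderE [#|_|]c4.
Qed.

Lemma abelem_Z2xZ2 : 2.-abelem [set: ('Z_2 * 'Z_2)%type].
Proof.
apply/(abelemP (isT : prime 2)); split.
  by apply/centsP => -[a b] _ [c d] _; congr pair; apply: val_inj; rewrite /= addnC.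
move=> [a b] _; rewrite expgS expg1.
by case: a b => [[|[|]] //= ?] [[|[|]] //= ?]; congr pair; apply: val_inj.
Qed.

Lemma card_Z2xZ2 : #|[set: ('Z_2 * 'Z_2)%type]| = 4.
Proof. by rewrite cardsT card_prod !card_ord. Qed.

Lemma group_set_pullback (l1 l2 : {morphism [set: gsort 'D_8] >-> 'Z_2}) :
  group_set (pullback l1 l2).
Proof.
apply/group_setP; split=> [|[u v] [u' v']]; rewrite !inE ?morph1 //=.
by move=> /eqP e /eqP e'; rewrite !morphM ?inE // e e'.
Qed.

Canonical pullback_group l1 l2 := Group (group_set_pullback l1 l2).

Section IndicatorMorphism.
Variables (gT : finGroupType) (V : {group gT}).
Hypothesis index2 : #|[set: gT]| = (2 * #|V|)%N.

(** In the group scope [1] is the neutral element of ['Z_2], that is the residue 0, and [Zp1] is the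
    generator. *)
Definition index2_char (g : gT) : 'Z_2 := if g \in V then 1 else Zp1.

Lemma index2_charM : {in [set: gT] &, {morph index2_char : g h / g * h}}.
Proof.
move=> g h _ _; rewrite /index2_char.
have [Vg|V'g] := boolP (g \in V); first by rewrite groupMl // mul1g.
have [Vh|V'h] := boolP (h \in V); first by rewrite groupMr // (negPf V'g) mulg1.
rewrite (index2_mul (subsetT V) index2); last by rewrite !inE V'h.
  by apply: val_inj.
by rewrite !inE V'g.
Qed.

Canonical index2_char_morphism := Morphism index2_charM.

Lemma ker_index2_char : 'ker index2_char = V.
Proof.
apply/setP => g; rewrite !inE /= /index2_char.
by case: ifP.
Qed.
End IndicatorMorphism.

(** A concrete model: [X] is diagonal while [Y] and [Z] live in different factors, so [[~ X, Z]]
    commutes with [Y]. It shows that the bound 32 is attained, and one choice of [l] is enough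
    because [isog_DwedgeD] quantifies existentially over the two morphisms. *)
Lemma D8_pullback_triple :
  exists (l : {morphism [set: gsort 'D_8] >-> 'Z_2}) (X Y Z : ('D_8 * 'D_8)%type),
    [/\ 'ker l \isog [set: ('Z_2 * 'Z_2)%type], G2_relations X Y Z,
        [~ Y, [~ X, Z]] = 1, #|gen3 X Y Z| = 32 & gen3 X Y Z = pullback l l].
Proof.
have [x [v [x2 v2 xv4 gen]]] := D8_generators.
pose V := (<[v]> <*> <[v ^ x]>)%G.
have [cV _] := card_D8_klein x2 v2 xv4 gen.
have c2 : #|[set: gsort 'D_8]| = (2 * #|V|)%N by rewrite card_D8 cV.
pose l := index2_char_morphism c2.
have lP g h : (l g == l h) = ((g \in V) == (h \in V)).
  by rewrite /= /index2_char; do 2!case: ifP.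
have V'x : x \notin V.
  apply/negP => Vx; have := card_D8; rewrite -gen => c8.
  have: <[x]> <*> <[v]> \subset V by rewrite join_subG !cycle_subG Vx -cycle_subG joing_subl.
  by move/subset_leq_card; rewrite c8 cV.
have Vv : v \in V by rewrite -cycle_subG joing_subl.
have Vvx : v ^ x \in V by rewrite -cycle_subG joing_subr.
pose X : ('D_8 * 'D_8)%type := (x, x); pose Y : ('D_8 * 'D_8)%type := (v, 1).
pose Z : ('D_8 * 'D_8)%type := (1, v).
have w1 : [~ Y, [~ X, Z]] = 1.
  by rewrite -[LHS]/([~ v, [~ x, 1]], [~ 1, [~ x, v]]) !(commg1, comm1g).
have w1' : [~ Z, [~ X, Y]] = 1.
  by rewrite -[LHS]/([~ 1, [~ x, v]], [~ v, [~ x, 1]]) !(commg1, comm1g).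
have xv2 := D8_comm2 x2 v2 xv4.
have rel : G2_relations X Y Z.
  have pR (g g' h h' : 'D_8) : [~ (g, h), (g', h')] = ([~ g, g'], [~ h, h']) by [].
  have p2 (g h : 'D_8) : (g, h) ^+ 2 = (g ^+ 2, h ^+ 2) by [].
  split; split; rewrite ?w1 ?w1' ?pR ?p2 ?x2 ?v2 ?commg1 ?comm1g ?expg1n ?xv2 //.
exists l, X, Y, Z.
have DT : gen3 X Y Z = pullback l l.
  apply/eqP; rewrite eqEsubset; apply/andP; split.
    by rewrite (gen3_sub X Y Z (pullback_group l l)) !inE /= !lP !group1 Vv !eqxx.
  apply/subsetP => -[u u']; rewrite !inE lP /= => uu'.
  have [TX TY TZ] := mem_gen3 X Y Z.
  (* The first projection is onto, so it remains to reach its kernel in the pullback, which is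
     [1 x V], generated by [Z] and [Z ^ X = (1, v ^ x)]. *)
  have im : fst_morphism ('D_8)%type ('D_8)%type @* gen3 X Y Z = [set: 'D_8].
    rewrite !morphimY ?subsetT // !morphim_cycle ?inE //= cycle1 joingG1. exact: gen.
  have : u \in fst_morphism ('D_8)%type ('D_8)%type @* gen3 X Y Z by rewrite im inE.
  case/morphimP=> -[t t'] _ Tt /= Du.
  have Vt : u'* t'^-1 \in V.
    have : (t, t') \in pullback l l.
      apply: (subsetP _ _ Tt).
      by rewrite (gen3_sub X Y Z (pullback_group l l)) !inE /= !lP !group1 Vv !eqxx.
    rewrite inE lP /= -Du => /eqP e; move: uu'; rewrite e => /eqP e'.
    have [Vu'|V'u'] := boolP (u' \in V).
      by rewrite groupMl // groupV e'.
    have V't' : t' \notin V by rewrite e'.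
    by apply: (index2_mul (subsetT V) c2); rewrite in_setD in_setT andbT ?groupV.
  have -> : (u, u') = (1, u' * t'^-1) * (t, t').
    by rewrite -[RHS]/(1 * t, u' * t'^-1 * t') mul1g mulgKV Du.
  rewrite groupM //.
  have VT : pair1g_morphism ('D_8)%type ('D_8)%type @* V \subset gen3 X Y Z.
    rewrite morphimY ?subsetT // !morphim_cycle ?inE // join_subG !cycle_subG.
    rewrite TZ /= (_ : pair1g _ _ = Z ^ X) ?groupJ //.
    by rewrite -[RHS](_ : (1 ^ x, v ^ x) = _) // conj1g.
  by apply: (subsetP VT); apply: (mem_morphim (pair1g_morphism _ _)); rewrite ?inE.
split=> //.
- rewrite ker_index2_char (@isog_abelem_card _ _ 2) //; last first.
  have aV := D8_klein_abelian x2 v2 xv4.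
  apply/(abelemP (isT : prime 2)); split=> // g; rewrite /= cent_joinEr; last first.
    by move: aV; rewrite abelianY => /and3P[].
  case/mulsgP=> _ _ /cycleP[i ->] /cycleP[j ->] ->; rewrite expgMn; last first.
    by apply: (centsP aV); rewrite groupX.
  by rewrite -!expgM !(mulnC _ 2) !expgM -conjXg v2 conj1g !expg1n mulg1.
  by rewrite abelem_Z2xZ2 cV card_Z2xZ2.
- have -> : gen3 X Y Z = setX V V :|: setX (~: V) (~: V).
    apply/setP => -[u u']; rewrite DT !inE lP /=.
    by case: (u \in V) (u' \in V) => [] [].
  rewrite cardsU !cardsX (_ : _ :&: _ = set0) ?cards0 => [|].
    by rewrite [#|~: _|]cardsCs setCK -cardsT card_D8 cV.
  by apply/setP => -[u u']; rewrite !inE /=; case: (u \in V) (u' \in V) => [] [].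
Qed.

(** Index at most two, phrased through products so that it passes to preimages without counting;
    properness is witnessed by the explicit elements of [twin_klein]. *)
Definition index2_in (gT : finGroupType) (E U : {set gT}) :=
  U \subset E /\ forall g h, g \in E :\: U -> h \in E :\: U -> g * h \in U.

(* In D x D the groups [U1], [U2] are [<v> x V], [V x <v>], with [V] the given
   Klein subgroup of D and [v \in V] not central. *)
Definition twin_klein (gT : finGroupType) (G : {group gT}) :=
  exists (E U1 U2 : {group gT}) (x y z : gT),
    [/\ index2_in G E, index2_in E U1, index2_in E U2 & x \in G :\: E] /\
    [/\ y \in U1, y ^ x^-1 \in E :\: U1, y \in U2 & y ^ x^-1 \in U2] /\
    [/\ z \in U1, z ^ x^-1 \in U1, z \in U2 & z ^ x^-1 \in E :\: U2].

(** Subgroups and witnesses are pulled back along the surjection. This replaces the passage to the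
    subextension with group [H]: the Galois group [G] is used directly. *)
Lemma twin_klein_morphpre (gT hT : finGroupType) (G : {group gT}) (H : {group hT}) :
  H \homg G -> twin_klein H -> twin_klein G.
Proof.
case/homgP=> f DH [E [U1 [U2 [x [y [z [[iE i1 i2 xE] [[y1 y1' y2 y2'] [z1 z1' z2 z2']]]]]]]]].
have pre (A B : {group hT}) : index2_in A B -> index2_in (f @*^-1 A) (f @*^-1 B).
  case=> sBA mulB; split; first exact: morphpreS.
  move=> g h; rewrite !inE => /andP[Bg /andP[Gg Ag]] /andP[Bh /andP[Gh Ah]].
  move: Bg Bh; rewrite Gg Gh /= => Bg Bh.
  by rewrite groupM //= morphM // mulB // inE ?Bg ?Bh.
have preG : f @*^-1 H = G.
  by apply/setP => g; rewrite !inE andb_idr // -DH => Gg; rewrite mem_morphim.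
have [sEH _] := iE; have [sU1E _] := i1; have [sU2E _] := i2.
have [x' Gx' Dx] : exists2 g', g' \in G & f g' = x.
  by have [Hx _] := setDP xE; move: Hx; rewrite -DH => /morphimP[g' _ Gg' ->]; exists g'.
have [y' Gy' Dy] : exists2 g', g' \in G & f g' = y.
  have := subsetP sEH _ (subsetP sU1E _ y1).
  by rewrite -DH => /morphimP[g' _ Gg' ->]; exists g'.
have [z' Gz' Dz] : exists2 g', g' \in G & f g' = z.
  have := subsetP sEH _ (subsetP sU1E _ z1).
  by rewrite -DH => /morphimP[g' _ Gg' ->]; exists g'.
exists [group of f @*^-1 E], [group of f @*^-1 U1], [group of f @*^-1 U2], x', y', z'.
have iE' := pre H E iE; rewrite preG in iE'.
have J g : g \in G -> f (g ^ x'^-1) = f g ^ x^-1.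
  by move=> Gg; rewrite morphJ ?groupV // morphV // Dx.
have GJ g : g \in G -> g ^ x'^-1 \in G by move=> Gg; rewrite groupJ ?groupV.
have mE (A : {group hT}) g : g \in G -> (g \in f @*^-1 A) = (f g \in A).
  by move=> Gg; rewrite !inE Gg.
move: xE y1' z2'; rewrite !in_setD => /andP[E'x _] y1' z2'.
split; [split|split; split]; rewrite /= ?in_setD ?mE ?J ?GJ ?Dx ?Dy ?Dz ?E'x //.
- exact: pre.
- exact: pre.
Qed.

Lemma mem_Z2_neq1 (i j : 'Z_2) : i != 1 -> j != 1 -> i = j.
Proof. by case: i j => [[|[|]] // ?] [[|[|]] // ?] _ _; apply: val_inj. Qed.

Section PullbackKlein.
Variable l : {morphism [set: gsort 'D_8] >-> 'Z_2}.
Hypothesis kerl : 'ker l \isog [set: ('Z_2 * 'Z_2)%type].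

Lemma card_ker_klein : #|'ker l| = 4.
Proof. by rewrite (card_isog kerl) card_Z2xZ2. Qed.

Lemma abelem_ker_klein : 2.-abelem ('ker l).
Proof. by rewrite (isog_abelem kerl) abelem_Z2xZ2. Qed.

Lemma index_ker_klein : #|[set: gsort 'D_8]| = (2 * #|'ker l|)%N.
Proof. by rewrite card_ker_klein card_D8. Qed.

Lemma notin_ker_klein : exists x, x \notin 'ker l.
Proof.
have /subsetPn[x _ V'x] : ~~ ([set: gsort 'D_8] \subset 'ker l).
  by apply/negP => /subset_leq_card; rewrite card_D8 card_ker_klein.
by exists x.
Qed.

(** The kernel may be either Klein subgroup of D, so only its being elementary abelian of index two
    is used. If [x^-1] centralized it, D would be abelian; and a nontrivial conjugate of an
    involution [v] other than [v] lies outside [<[v]>]. *)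
Lemma ker_klein_moved x : x \notin 'ker l ->
  exists v, [/\ v \in 'ker l, v ^ x^-1 \in 'ker l, v ^ x^-1 \notin <[v]> & #|<[v]>| = 2].
Proof.
move=> V'x; have aV := abelem_abelian abelem_ker_klein.
have DG : [set: gsort 'D_8] \subset 'ker l <*> <[x]>.
  apply/subsetP => g _; have [Vg|V'g] := boolP (g \in 'ker l).
    by rewrite (subsetP (joing_subl _ _)).
  have Vgx : g * x \in 'ker l.
    by apply: (index2_mul (subsetT _) index_ker_klein); rewrite in_setD in_setT andbT.
  rewrite -[g](mulgK x) groupM //; first by rewrite (subsetP (joing_subl _ _)).
  by rewrite groupV (subsetP (joing_subr _ _)) // cycle_id.
have /subsetPn[v Vv nxv] : ~~ ('ker l \subset 'C[x^-1]).
  apply/negP => cVx; have : abelian [set: gsort 'D_8].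
    apply: abelianS DG _; rewrite abelianY aV cycle_abelian cycle_subG /=.
    by rewrite -groupV -sub_cent1.
  by apply/negP; apply: D8_nonabelian.
have [_ /(_ v Vv) v2] := abelemP (isT : prime 2) abelem_ker_klein.
have nv1 : v != 1 by apply: contraNneq nxv => ->; rewrite group1.
have ov : #|<[v]>| = 2.
  by rewrite -orderE; apply: nt_prime_order.
have v'1 : v ^ x^-1 != v by apply: contraNneq nxv => e; apply/cent1P/commgP/conjg_fixP.
exists v; split=> //; first by rewrite memJ_norm // (subsetP (ker_norm _)).
by rewrite cycle2g // !inE negb_or v'1 andbT conjg_eq1.
Qed.
End PullbackKlein.

Lemma twin_klein_pullback (l1 l2 : {morphism [set: gsort 'D_8] >-> 'Z_2}) :
    'ker l1 \isog [set: ('Z_2 * 'Z_2)%type] -> 'ker l2 \isog [set: ('Z_2 * 'Z_2)%type] ->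
  twin_klein (pullback_group l1 l2).
Proof.
move=> k1 k2; have [x1 V'x1] := notin_ker_klein k1; have [x2 V'x2] := notin_ker_klein k2.
have [v1 [Vv1 Vv1' v1' c1]] := ker_klein_moved k1 V'x1.
have [v2 [Vv2 Vv2' v2' c2]] := ker_klein_moved k2 V'x2.
have kE (l : {morphism [set: gsort 'D_8] >-> 'Z_2}) g : (g \in 'ker l) = (l g == 1).
  by rewrite !inE.
have memP u v : ((u, v) \in pullback l1 l2) = ((u \in 'ker l1) == (v \in 'ker l2)).
  rewrite !kE inE /=; case: (eqVneq (l1 u) 1) => [->|u1].
    by rewrite eq_sym; case: (_ == 1).
  case: (eqVneq (l2 v) 1) => [->|v1n]; first by rewrite (negPf u1).
  by rewrite (mem_Z2_neq1 u1 v1n) !eqxx.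
have half (l : {morphism [set: gsort 'D_8] >-> 'Z_2}) v g h :
    'ker l \isog [set: ('Z_2 * 'Z_2)%type] -> #|<[v]>| = 2 -> v \in 'ker l ->
    g \in 'ker l :\: <[v]> -> h \in 'ker l :\: <[v]> -> g * h \in <[v]>.
  move=> k c Vv; apply: index2_mul; first by rewrite cycle_subG.
  by rewrite card_ker_klein // c.
pose E := (setX_group ('ker l1)%G ('ker l2)%G).
pose U1 := (setX_group <[v1]>%G ('ker l2)%G).
pose U2 := (setX_group ('ker l1)%G <[v2]>%G).
exists E, U1, U2, (x1, x2), (v1, 1), (1, v2).
have conjE (g h g' h' : 'D_8) : (g, h) ^ (g', h')^-1 = (g ^ g'^-1, h ^ h'^-1) by [].
split; [split|split; split]; rewrite ?conjE ?conj1g ?in_setD ?in_setX ?memP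
  ?group1 ?cycle_id ?Vv1 ?Vv2 ?Vv1' ?Vv2' ?v1' ?v2' ?V'x1 ?V'x2 ?(negPf V'x1) ?(negPf V'x2) //=.
- split; first by apply/subsetP => -[u v]; rewrite in_setX memP => /andP[-> ->].
  move=> [u v] [u' v']; rewrite !in_setD !in_setX !memP /=.
  case Vu: (u \in 'ker l1); case Vv: (v \in 'ker l2) => //= _.
  case Vu': (u' \in 'ker l1); case Vv': (v' \in 'ker l2) => //= _.
  rewrite ?in_setX /=.
  by apply/andP; split; [apply: (index2_mul (subsetT _) (index_ker_klein k1)) |
    apply: (index2_mul (subsetT _) (index_ker_klein k2))];
    rewrite in_setD in_setT ?Vu ?Vu' ?Vv ?Vv'.
- split; first by rewrite setXS // cycle_subG.
  move=> [u v] [u' v']; rewrite !in_setD !in_setX /= => /and3P[a b c] /and3P[a' b' c'].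
  rewrite ?in_setX /=; apply/andP; split; last exact: groupM.
  by apply: (half l1) => //; rewrite in_setD ?b ?b' andbT;
    [move: a | move: a']; rewrite ?c ?c' andbT.
- split; first by rewrite setXS // cycle_subG.
  move=> [u v] [u' v']; rewrite !in_setD !in_setX /= => /and3P[a b c] /and3P[a' b' c'].
  rewrite ?in_setX /=; apply/andP; split; first exact: groupM.
  by apply: (half l2) => //; rewrite in_setD ?c ?c' andbT;
    [move: a | move: a']; rewrite ?b ?b'.
- by rewrite !andbT.
Qed.

Lemma DwedgeD_twin_klein (gT : finGroupType) (G : {group gT}) :
  isog_DwedgeD G -> twin_klein G.
Proof.
case=> l1 [l2 [k1 [k2 isoG]]]; apply: twin_klein_morphpre (twin_klein_pullback k1 k2).
by apply: isog_hom; rewrite isog_sym.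
Qed.

(** The model triple satisfies the relations of G2, with trivial [[~ Y, [~ X, Z]]], so the
    presentation maps [G] onto the pullback. *)
Lemma G2_twin_klein (gT : finGroupType) (G : {group gT}) : isog_G2 G -> twin_klein G.
Proof.
have [l [X [Y [Z [kl rel _ _ DT]]]]] := D8_pullback_triple.
move=> isoG; apply: twin_klein_morphpre (twin_klein_pullback kl kl).
by rewrite isoG; apply/G2_homGrpP; exists X, Y, Z.
Qed.

Lemma gen3_DwedgeD (gT : finGroupType) (x y z : gT) :
    G2_relations x y z -> [~ y, [~ x, z]] = 1 -> #|gen3 x y z| = 32 ->
  isog_DwedgeD (gen3 x y z).
Proof.
have [l [X [Y [Z [kl rel W1 C DT]]]]] := D8_pullback_triple.
by move=> rel' w1 c; exists l, l; do 2!split=> //; rewrite -DT; apply: gen3_isog.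
Qed.

Local Close Scope group_scope.

(** * Norms from a Galois group mapping onto DwedgeD *)

Section TwinKleinGalois.
Variables (F : fieldType) (L : splittingFieldType F).
Hypothesis char_ne2 : (2%:R : F) != 0.
Hypothesis galL : galois (1%VS : {vspace L}) fullv.
Local Notation gal := (gal_of (fullv : {vspace L})).

(** A Lagrange resolvent: by the Galois correspondence some [y] fixed by [U] is moved by [s0], and
    [y - s0 y] realizes the quadratic character of [E] with kernel [U]. *)
Lemma index2_sign (E U : {group gal}) (s0 : gal) :
    index2_in E U -> s0 \in (E :\: U)%g ->
  exists x : L, [/\ x != 0, forall s, s \in U -> s x = x &
                    forall s, s \in (E :\: U)%g -> s x = - x].
Proof.
case=> sUE mulU s0E; have [Es0 U's0] := setDP s0E.
have [y fixy movy] : exists2 y, y \in fixedField U & s0 y != y.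
  apply: NNPP => no; case/negP: U's0; rewrite -(gal_fixedField U) gal_kHom ?subvf //.
  apply/kAHomP => y fixy; apply: contraPeq no => movy; case; by exists y.
have fixU s : s \in U -> s y = y by move=> Us; have [_] := mem_fixedFieldP fixy; apply.
have V'V s : s \in (E :\: U)%g -> (s^-1)%g \in (E :\: U)%g.
  by rewrite !in_setD !groupV.
have s0s s : s \in (E :\: U)%g -> s y = s0 y.
  by move=> Us; rewrite -[s](mulgKV s0) gal_mul fixU // mulU // V'V.
exists (y - s0 y); split=> [|s Us|s s_EU].
- by rewrite subr_eq0 eq_sym.
- rewrite rmorphB /= fixU // -gal_mul s0s // in_setD.
  by rewrite groupMr // U's0 groupM // (subsetP sUE).
- rewrite rmorphB /= s0s // -gal_mul.
  by rewrite (fixU (s0 * s)%g) ?mulU // opprB.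
Qed.

Lemma base_fixed x : (forall s : gal, s x = x) -> exists k : F, x = k%:A.
Proof.
move=> fix_x; suff /vlineP : x \in (1%VS : {vspace L}) by [].
have /galois_fixedField <- := galL.
by apply/fixedFieldP; rewrite ?memvf.
Qed.

Lemma twin_klein_norms :
    twin_klein [group of 'Gal({:L} / 1)%g] ->
  exists a b c : F, [/\ a != 0, b != 0 & c != 0] /\
    indep_mod_sq3 a b c /\ DF2 1 (- a) b /\ DF2 1 (- a) c.
Proof.
case=> E [U1 [U2 [x [y [z [[iE i1 i2 xE] [[y1 y1' y2 y2'] [z1 z1' z2 z2']]]]]]]].
have inG s : s \in [group of 'Gal({:L} / 1)%g] by apply: mem_gal1.
have [r [nzr fixr negr]] := index2_sign iE xE.
have [s [nzs fixs negs]] := index2_sign i1 y1'.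
have [t [nzt fixt negt]] := index2_sign i2 z2'.
have [sEG mulE] := iE; have [sU1E _] := i1; have [sU2E _] := i2.
have xr : x r = - r := negr x xE.
have nE g : g \in E \/ g \in ([group of 'Gal({:L} / 1)%g] :\: E)%g.
  by rewrite in_setD inG andbT; case: (g \in E); [left|right].
have JE g : g \in E -> (g ^ x^-1)%g \in E.
  move=> Eg; case: (nE (g ^ x^-1)%g) => // nEg.
  have xVE : (x^-1)%g \in ([group of 'Gal({:L} / 1)%g] :\: E)%g.
    by move: xE; rewrite !in_setD !groupV.
  have := mulE _ _ xVE nEg; rewrite conjgE invgK !mulgA mulVg mul1g.
  by rewrite groupMl // groupV; case/setDP: xE => _ /negPf->.
(* Automorphisms compose from left to right, so [g] acts on [x u] through the conjugate of [g] by
   [x^-1]; hence these conjugates in [twin_klein]. *)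
have swap (g : gal) (u : L) : g (x u) = x ((g ^ x^-1)%g u).
  by rewrite -!gal_mul conjgE invgK mulgA mulgKV.
have [a Da] : exists a : F, r ^+ 2 = a%:A.
  apply: base_fixed => g; rewrite rmorphXn /=.
  by case: (nE g) => [/fixr->|/negr->]; rewrite ?sqrrN.
have xx_E : (x * x)%g \in E by apply: mulE.
(* The even part of [k] under [x], and its odd part divided by [r], are fixed by [E] and by [x],
   hence by the whole group. *)
have decomp (k : L) : (forall g : gal, g \in E -> g k = k) ->
    exists p q : F, k = p%:A + q%:A * r /\ x k = p%:A - q%:A * r.
  move=> fixk; have xxk : x (x k) = k by rewrite -gal_mul fixk.
  have Efix (g : gal) : g \in E -> g (x k) = x k by move=> Eg; rewrite swap fixk ?JE.
  have full (u : L) : (forall g : gal, g \in E -> g u = u) -> x u = u ->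
      forall g : gal, g u = u.
    move=> fu xu g; case: (nE g) => [/fu//|nEg].
    have := fu _ (mulE _ _ xE nEg); rewrite gal_mul xu //.
  have [p Dp] : exists p : F, (k + x k) / 2%:R = p%:A.
    apply/base_fixed/full => [g Eg|]; rewrite fmorph_div rmorphD rmorph_nat /=.
      by rewrite (fixk g) // (Efix g).
    by rewrite xxk addrC.
  have [q Dq] : exists q : F, (k - x k) / (2%:R * r) = q%:A.
    apply/base_fixed/full => [g Eg|]; rewrite fmorph_div rmorphB rmorphM rmorph_nat /=.
      by rewrite (fixk g) // (Efix g) // fixr.
    by rewrite xxk xr mulrN invrN mulrN -mulNr opprB.
  have nz2 := ext_char_ne2 L char_ne2.
  by exists p, q; rewrite -Dp -Dq; split; field; rewrite nzr nz2.
have norm (U : {group gal}) u : U \subset E -> (forall g : gal, g \in U -> g u = u) ->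
    (forall g : gal, g \in (E :\: U)%g -> g u = - u) ->
    exists p q : F, (u * x u) ^+ 2 = (p ^+ 2 - a * q ^+ 2)%:A.
  move=> sUE fixu negu; have [|p [q [Dp Dq]]] := decomp (u ^+ 2).
    move=> g Eg; rewrite rmorphXn /=; have [Ug|U'g] := boolP (g \in U).
      by rewrite fixu.
    by rewrite negu ?sqrrN // in_setD U'g.
  exists p, q; move: Dq; rewrite rmorphXn /= => Dq; rewrite exprMn Dp Dq.
  rewrite -!in_algE !(rmorphB, rmorphM, rmorphXn) /= -Da; ring.
have [p1 [q1 Db]] := norm U1 s sU1E fixs negs.
have [p2 [q2 Dc]] := norm U2 t sU2E fixt negt.
set b := (p1 ^+ 2 - _) in Db; set c := (p2 ^+ 2 - _) in Dc.
have nz k (u : L) : u != 0 -> u ^+ 2 = k%:A -> k != 0.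
  by move=> nzu Du; apply: contraNneq nzu => k0; rewrite -sqrf_eq0 Du k0 scale0r.
have nzx (u : L) : u != 0 -> u * x u != 0.
  by move=> nzu; rewrite mulf_neq0 // fmorph_eq0.
have [nza nzb nzc] : [/\ a != 0, b != 0 & c != 0].
  by split; [apply: nz Da | apply: nz Db | apply: nz Dc] => //; apply: nzx.
exists a, b, c; split=> //; split; last first.
  split; split=> //; first by exists p1, q1; rewrite /b mul1r mulNr.
  by exists p2, q2; rewrite /c mul1r mulNr.
(* A square relation between [a], [b], [c] puts the monomial [m] in [F]. But [y] changes only the
   sign of [s * x s] and [z] only that of [t * x t], so these factors do not occur in [m]; then [x],
   which negates [r], excludes the last one. *)
move=> e1 e2 e3 e [f [nzf Df]].
pose m := r ^+ e1 * (s * x s) ^+ e2 * (t * x t) ^+ e3.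
have nzm : m != 0 by rewrite !mulf_neq0 ?expf_neq0 ?nzx.
have fixm (g : gal) : g m = m.
  have : m ^+ 2 == (f%:A) ^+ 2.
    rewrite /m !exprMn -!(exprM _ _ 2) !(mulnC _ 2%N) !exprM -!exprMn Da Db Dc.
    by rewrite -!in_algE -!rmorphXn -!rmorphM /= Df.
  have fixf : g f%:A = f%:A by rewrite linearZ /= rmorph1.
  by rewrite eqf_sqr => /orP[] /eqP->; rewrite ?rmorphN /= fixf.
have yr : y r = r by apply/fixr/(subsetP sU1E).
have zr : z r = r by apply/fixr/(subsetP sU1E).
have ys : y (s * x s) = - (s * x s).
  by rewrite rmorphM /= swap (fixs y) // (negs (y ^ x^-1)%g) // rmorphN mulrN.
have yt : y (t * x t) = t * x t by rewrite rmorphM /= swap (fixt y) // (fixt (y ^ x^-1)%g).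
have zs : z (s * x s) = s * x s by rewrite rmorphM /= swap (fixs z) // (fixs (z ^ x^-1)%g).
have zt : z (t * x t) = - (t * x t).
  by rewrite rmorphM /= swap (fixt z) // (negt (z ^ x^-1)%g) // rmorphN mulrN.
have := neq_opp char_ne2 nzm; have := fixm x; have := fixm z; have := fixm y.
rewrite /m !(rmorphM, rmorphXn) /= -!rmorphM /= yr zr ys yt zs zt xr.
clear m nzm fixm Df.
case: e2 e => e.
  by move=> ey _ _ /eqP[]; move: ey; rewrite expr1 mulrN mulNr => ->.
case: e3 e => e.
  by move=> _ ez _ /eqP[]; move: ez; rewrite expr1 mulrN => ->.
by case: e1 e => // _ _ _; rewrite expr1 !mulr1 => ->; rewrite eqxx.
Qed.

End TwinKleinGalois.

(** * Realizing both groups *)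

Section Generators.
Variables (F : fieldType) (L : splittingFieldType F) (a p q : F).
Hypothesis char_ne2 : (2%:R : F) != 0.
Hypothesis galL : galois (1%VS : {vspace L}) fullv.
Local Notation gal := (gal_of (fullv : {vspace L})).
Local Notation b := (p ^+ 2 - a * q ^+ 2).
Local Notation c := ((1 - p) ^+ 2 - a * q ^+ 2).
Hypotheses (nza : a != 0) (nzb : b != 0) (nzc : c != 0).
Hypothesis indep : indep_mod_sq3 a b c.
Variables (r s1 s2 t1 t2 : L).
Hypothesis eqs : five_roots a p q r s1 s2 t1 t2.

Let acts (g : gal) (v : seq L) := map g [:: r; s1; s2; t1; t2] = v.

Lemma five_roots_neq0 : [/\ r != 0, s1 != 0, s2 != 0, t1 != 0 & t2 != 0].
Proof.
have [Dr _ _ _ _] := eqs; have [Db Dc] := five_roots_norm eqs.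
have nz (u : L) k : k != 0 -> u ^+ 2 = k%:A -> u != 0.
  by move=> nzk Du; rewrite -sqrf_eq0 Du scaler_eq0 negb_or nzk oner_neq0.
have := nz _ _ nzb Db; have := nz _ _ nzc Dc; have := nz _ _ nza Dr.
by rewrite !mulf_eq0 !negb_or => -> /andP[-> ->] /andP[-> ->].
Qed.

Lemma five_roots_pm1_neq0 : [/\ 1 + s1 != 0, 1 - s1 != 0, 1 + s2 != 0 & 1 - s2 != 0].
Proof.
have [_ _ _ nzt1 nzt2] := five_roots_neq0; have [_ _ _ Dt1 Dt2] := eqs.
have D1 : (1 - s1) * (1 + s1) = t2 ^+ 2 by rewrite Dt2; ring.
have D2 : (1 - s2) * (1 + s2) = t1 ^+ 2 by rewrite Dt1; ring.
have : (1 - s1) * (1 + s1) != 0 by rewrite D1 expf_neq0.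
have : (1 - s2) * (1 + s2) != 0 by rewrite D2 expf_neq0.
by rewrite !mulf_eq0 !negb_or => /andP[-> ->] /andP[-> ->].
Qed.

Lemma sign_pair (g : gal) (x y x' y' : L) :
    x' != 0 -> (g x) ^+ 2 = x' ^+ 2 -> g (x * y) = x' * y' ->
  g x = x' /\ g y = y' \/ g x = - x' /\ g y = - y'.
Proof.
move=> nzx' /eqP; rewrite eqf_sqr rmorphM /= => /orP[] /eqP->.
  by move/(mulfI nzx'); left.
by rewrite mulNr -mulrN => /(mulfI nzx')/eqP; rewrite eqr_oppLR => /eqP; right.
Qed.

(** Independence prescribes signs only on [r], [s1 * s2] and [t1 * t2], which leaves a common sign
    undetermined on [s1, s2] and on [t1, t2]. The automorphisms [P] and [Q] below realize exactly
    these two ambiguities, whichever signs [X0], [Y0], [Z0] have, and so correct them. *)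
Lemma acts_generators :
  exists X Y Z : gal, [/\ acts X [:: - r; s2; s1; t2; t1],
    acts Y [:: r; - s1; s2; t1; t2] & acts Z [:: r; s1; s2; - t1; t2]].
Proof.
have [Dr Ds1 Ds2 Dt1 Dt2] := eqs; have [Db Dc] := five_roots_norm eqs.
have [nzr nzs1 nzs2 nzt1 nzt2] := five_roots_neq0.
set u := s1 * s2 in Db; set v := t1 * t2 in Dc.
have [_ _ r_uv] :
    [/\ u \notin (1%VS : {vspace L}), v \notin <<1; u>>%VS & r \notin <<<<1; u>>; v>>%VS].
  apply: indep_sqrt_tower Db Dc Dr => // e1 e2 e3 e; rewrite mulrC mulrA.
  by apply: indep; case: e1 e2 e3 e => [] [] [].
have [_ _ v_ru] :
    [/\ r \notin (1%VS : {vspace L}), u \notin <<1; r>>%VS & v \notin <<<<1; r>>; u>>%VS].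
  by apply: indep_sqrt_tower Dr Db Dc.
have [_ _ u_rv] :
    [/\ r \notin (1%VS : {vspace L}), v \notin <<1; r>>%VS & u \notin <<<<1; r>>; v>>%VS].
  apply: indep_sqrt_tower Dr Dc Db => // e1 e2 e3 e; rewrite mulrAC; apply: indep.
  by case: e1 e2 e3 e => [] [] [].
have in1 k : k%:A \in (1%AS : {subfield L}) by rewrite rpredZ // mem1v.
have in2 (x y z : L) k : z ^+ 2 = k%:A -> z ^+ 2 \in <<<<1%AS; x>>%AS; y>>%AS.
  by move=> ->; do 2!apply: subvP_adjoin.
have neg (x y z : L) k : z ^+ 2 = k%:A -> z \notin <<<<1%AS; x>>%AS; y>>%AS ->
    exists g : gal, [/\ g x = x, g y = y & g z = - z].
  move=> Dz nz; have [g gK gz] := exists_gal_neg galL (in2 x y _ _ Dz) nz.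
  exists g; split=> //; apply: (fixed_gal (subvf _) gK).
    exact/subvP_adjoin/memv_adjoin.
  exact: memv_adjoin.
have [X0 [X0u X0v X0r]] := neg _ _ _ _ Dr r_uv.
have [Y0 [Y0r Y0v Y0u]] := neg _ _ _ _ Db u_rv.
have [Z0 [Z0r Z0u Z0v]] := neg _ _ _ _ Dc v_ru.
have Dk (k : F) (g : gal) : g k%:A = k%:A by rewrite linearZ /= rmorph1.
have sqr (g : gal) : g r = r -> [/\ (g s1) ^+ 2 = s1 ^+ 2, (g s2) ^+ 2 = s2 ^+ 2,
    (g t1) ^+ 2 = t1 ^+ 2 & (g t2) ^+ 2 = t2 ^+ 2].
  move=> gr; have g1 : (g s1) ^+ 2 = s1 ^+ 2.
    by rewrite -rmorphXn /= Ds1 rmorphD rmorphM /= !Dk gr.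
  have g2 : (g s2) ^+ 2 = s2 ^+ 2.
    by rewrite -rmorphXn /= Ds2 rmorphB rmorphM /= !Dk gr.
  by split=> //; rewrite -rmorphXn /= ?Dt1 ?Dt2 rmorphB rmorph1 rmorphXn /= ?g1 ?g2.
have [Y1 _ Y3 _] := sqr Y0 Y0r; have [Z1 _ Z3 _] := sqr Z0 Z0r.
have X1 : (X0 s1) ^+ 2 = s2 ^+ 2.
  by rewrite -rmorphXn /= Ds1 Ds2 rmorphD rmorphM /= !Dk X0r mulrN.
have X2 : (X0 s2) ^+ 2 = s1 ^+ 2.
  by rewrite -rmorphXn /= Ds1 Ds2 rmorphB rmorphM /= !Dk X0r mulrN opprK.
have X3 : (X0 t1) ^+ 2 = t2 ^+ 2.
  by rewrite -rmorphXn /= Dt1 Dt2 rmorphB rmorph1 rmorphXn /= X2.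
have {}Xs := sign_pair nzs2 X1 (etrans X0u (mulrC _ _)).
have {}Xt := sign_pair nzt2 X3 (etrans X0v (mulrC _ _)).
have {}Ys := sign_pair nzs1 Y1 (etrans Y0u (esym (mulrN _ _))).
have {}Yt := sign_pair nzt1 Y3 Y0v.
have {}Zs := sign_pair nzs1 Z1 Z0u.
have {}Zt := sign_pair nzt1 Z3 (etrans Z0v (esym (mulrN _ _))).
(* [(X0 Y0)^2] and [(X0 Z0)^2] play the role of the commutators [[X0, Y0]], [[X0, Z0]]. *)
have [P DP] : exists P : gal, acts P [:: r; - s1; - s2; t1; t2].
  exists ((X0 * Y0) * (X0 * Y0))%g; rewrite /acts /= !gal_mul.
  by case: Xs Xt Ys Yt => [] [Xs1 Xs2] [] [Xt1 Xt2] [] [Ys1 Ys2] [] [Yt1 Yt2];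
    do 8?rewrite ?X0r ?Y0r ?Xs1 ?Xs2 ?Xt1 ?Xt2 ?Ys1 ?Ys2 ?Yt1 ?Yt2 ?rmorphN /= ?opprK.
have [Q DQ] : exists Q : gal, acts Q [:: r; s1; s2; - t1; - t2].
  exists ((X0 * Z0) * (X0 * Z0))%g; rewrite /acts /= !gal_mul.
  by case: Xs Xt Zs Zt => [] [Xs1 Xs2] [] [Xt1 Xt2] [] [Zs1 Zs2] [] [Zt1 Zt2];
    do 8?rewrite ?X0r ?Z0r ?Xs1 ?Xs2 ?Xt1 ?Xt2 ?Zs1 ?Zs2 ?Zt1 ?Zt2 ?rmorphN /= ?opprK.
case: DP => Pr Ps1 Ps2 Pt1 Pt2; case: DQ => Qr Qs1 Qs2 Qt1 Qt2.
have [X DX] : exists X : gal, acts X [:: - r; s2; s1; t2; t1].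
  case: Xs Xt => [] [Xs1 Xs2] [] [Xt1 Xt2];
    [exists X0 | exists (X0 * Q)%g | exists (X0 * P)%g | exists (X0 * P * Q)%g];
    rewrite /acts /= ?gal_mul X0r Xs1 Xs2 Xt1 Xt2 ?rmorphN /=;
    rewrite ?Pr ?Ps1 ?Ps2 ?Pt1 ?Pt2 ?rmorphN /=;
    rewrite ?Qr ?Qs1 ?Qs2 ?Qt1 ?Qt2 ?opprK //.
have [Y DY] : exists Y : gal, acts Y [:: r; - s1; s2; t1; t2].
  case: Ys Yt => [] [Ys1 Ys2] [] [Yt1 Yt2];
    [exists (Y0 * P)%g | exists (Y0 * P * Q)%g | exists Y0 | exists (Y0 * Q)%g];
    rewrite /acts /= ?gal_mul Y0r Ys1 Ys2 Yt1 Yt2 ?rmorphN /=;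
    rewrite ?Pr ?Ps1 ?Ps2 ?Pt1 ?Pt2 ?rmorphN /=;
    rewrite ?Qr ?Qs1 ?Qs2 ?Qt1 ?Qt2 ?opprK //.
have [Z DZ] : exists Z : gal, acts Z [:: r; s1; s2; - t1; t2].
  case: Zs Zt => [] [Zs1 Zs2] [] [Zt1 Zt2];
    [exists (Z0 * Q)%g | exists Z0 | exists (Z0 * P * Q)%g | exists (Z0 * P)%g];
    rewrite /acts /= ?gal_mul Z0r Zs1 Zs2 Zt1 Zt2 ?rmorphN /=;
    rewrite ?Pr ?Ps1 ?Ps2 ?Pt1 ?Pt2 ?rmorphN /=;
    rewrite ?Qr ?Qs1 ?Qs2 ?Qt1 ?Qt2 ?opprK //.
by exists X, Y, Z.
Qed.

End Generators.

(** * Relations between the constructed automorphisms *)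

Section Relations.
Variables (F : fieldType) (L : splittingFieldType F) (xs : seq L).
Local Notation gal := (gal_of (fullv : {vspace L})).
Hypothesis gen : <<1 & xs>>%VS = {:L}%VS.

Lemma gal_eq_map (g h : gal) : map g xs = map h xs -> g = h.
Proof. by move/eq_in_map => e; apply: gal_eq_gen gen e. Qed.

Lemma commg_invol (g h : gal) : (g ^+ 2 = 1 -> h ^+ 2 = 1 -> [~ g, h] = g * (h * (g * h)))%g.
Proof.
by move=> g2 h2; rewrite commgEl conjgE !involution_inv.
Qed.

End Relations.

Section DwedgeDRelations.
Variables (F : fieldType) (L : splittingFieldType F) (r s1 s2 t1 t2 : L).
Local Notation gal := (gal_of (fullv : {vspace L})).
Hypothesis gen : <<1 & [:: r; s1; s2; t1; t2]>>%VS = {:L}%VS.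
Variables X Y Z : gal.
Hypothesis DX : map X [:: r; s1; s2; t1; t2] = [:: - r; s2; s1; t2; t1].
Hypothesis DY : map Y [:: r; s1; s2; t1; t2] = [:: r; - s1; s2; t1; t2].
Hypothesis DZ : map Z [:: r; s1; s2; t1; t2] = [:: r; s1; s2; - t1; t2].

(** Automorphisms are compared on the five roots. The commutators of [X] with [Y] and [Z] only
    change signs of roots, as do [Y] and [Z], so all of these commute. *)
Lemma DwedgeD_relations : G2_relations X Y Z /\ [~ Y, [~ X, Z]]%g = 1%g.
Proof.
case: DX => Xr Xs1 Xs2 Xt1 Xt2; case: DY => Yr Ys1 Ys2 Yt1 Yt2.
case: DZ => Zr Zs1 Zs2 Zt1 Zt2.
pose tabX := (Xr, Xs1, Xs2, Xt1, Xt2); pose tabY := (Yr, Ys1, Ys2, Yt1, Yt2).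
pose tabZ := (Zr, Zs1, Zs2, Zt1, Zt2).
have X2 : (X ^+ 2 = 1)%g.
  apply: (gal_eq_map gen); rewrite /= !gal_id expgS expg1 !gal_mul.
  by rewrite ?tabX ?rmorphN /= ?tabX ?opprK.
have Y2 : (Y ^+ 2 = 1)%g.
  apply: (gal_eq_map gen); rewrite /= !gal_id expgS expg1 !gal_mul.
  by rewrite ?tabY ?rmorphN /= ?tabY ?opprK.
have Z2 : (Z ^+ 2 = 1)%g.
  apply: (gal_eq_map gen); rewrite /= !gal_id expgS expg1 !gal_mul.
  by rewrite ?tabZ ?rmorphN /= ?tabZ ?opprK.
have DP : map [~ X, Y]%g [:: r; s1; s2; t1; t2] = [:: r; - s1; - s2; t1; t2].
  rewrite commg_invol //= !gal_mul.
  by do 4!rewrite ?tabX ?tabY ?rmorphN /= ?opprK.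
have DQ : map [~ X, Z]%g [:: r; s1; s2; t1; t2] = [:: r; s1; s2; - t1; - t2].
  rewrite commg_invol //= !gal_mul.
  by do 4!rewrite ?tabX ?tabZ ?rmorphN /= ?opprK.
have YZ : ([~ Y, Z] = 1)%g.
  apply: (gal_eq_map gen); rewrite /= !gal_id commg_invol // !gal_mul.
  by do 4!rewrite ?tabY ?tabZ ?rmorphN /= ?opprK.
rewrite /G2_relations YZ; move: [~ X, Y]%g [~ X, Z]%g DP DQ.
move=> P Q [Pr Ps1 Ps2 Pt1 Pt2] [Qr Qs1 Qs2 Qt1 Qt2].
pose tabP := (Pr, Ps1, Ps2, Pt1, Pt2); pose tabQ := (Qr, Qs1, Qs2, Qt1, Qt2).
have P2 : (P ^+ 2 = 1)%g.
  apply: (gal_eq_map gen); rewrite /= !gal_id expgS expg1 !gal_mul.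
  by rewrite ?tabP ?rmorphN /= ?tabP ?opprK.
have Q2 : (Q ^+ 2 = 1)%g.
  apply: (gal_eq_map gen); rewrite /= !gal_id expgS expg1 !gal_mul.
  by rewrite ?tabQ ?rmorphN /= ?tabQ ?opprK.
have W : ([~ Y, Q] = 1)%g.
  apply: (gal_eq_map gen); rewrite /= !gal_id commg_invol // !gal_mul.
  by do 4!rewrite ?tabY ?tabQ ?rmorphN /= ?opprK.
have W' : ([~ Z, P] = 1)%g.
  apply: (gal_eq_map gen); rewrite /= !gal_id commg_invol // !gal_mul.
  by do 4!rewrite ?tabZ ?tabP ?rmorphN /= ?opprK.
by rewrite W W' P2 Q2 !comm1g expg1n.
Qed.

Lemma DwedgeD_moved : r != - r -> s1 != - s1 -> s2 != - s2 -> t1 != - t1 -> t2 != - t2 ->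
  moved_along (gen3 X Y Z) 1%VS [:: r; s1; s2; t1; t2].
Proof.
move=> nr ns1 ns2 nt1 nt2; have [HX HY HZ] := mem_gen3 X Y Z.
case: DX => Xr Xs1 Xs2 Xt1 Xt2; case: DY => Yr Ys1 Ys2 Yt1 Yt2.
case: DZ => Zr Zs1 Zs2 Zt1 Zt2.
have G1 (g : gal) : g \in 'Gal({:L} / 1)%g by apply: mem_gal1.
have Zfix : [/\ Z r = r, Z s1 = s1, Z s2 = s2 & Z t2 = t2] by [].
(* The conjugates of [Y] and [Z] by [X] negate [s2] and [t2] in place of [s1] and [t1]. *)
have XYX : [/\ (X * Y * X)%g r = r, (X * Y * X)%g s1 = s1 & (X * Y * X)%g s2 = - s2].
  by split; rewrite !gal_mul ?Xr ?Xs1 ?Xs2 ?rmorphN /=;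
    rewrite ?Yr ?Ys1 ?Ys2 ?rmorphN /= ?Xr ?Xs1 ?Xs2 ?opprK.
have XZX1 : [/\ (X * Z * X)%g r = r, (X * Z * X)%g s1 = s1 & (X * Z * X)%g s2 = s2].
  by split; rewrite !gal_mul ?Xr ?Xs1 ?Xs2 ?rmorphN /=;
    rewrite ?Zr ?Zs1 ?Zs2 ?rmorphN /= ?Xr ?Xs1 ?Xs2 ?opprK.
have XZX2 : [/\ (X * Z * X)%g t1 = t1 & (X * Z * X)%g t2 = - t2].
  by split; rewrite !gal_mul ?Xt1 ?Xt2 /= ?Zt1 ?Zt2 ?rmorphN /= ?Xt1 ?Xt2.
case: XYX => a1 a2 a3; case: XZX1 => b1 b2 b3; case: XZX2 => b4 b5.
split; first by exists X; split; rewrite ?Xr // eq_sym.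
split; first by exists Y; split; [by [] | apply: gal_adjoin | by rewrite Ys1 eq_sym].
split.
  exists (X * Y * X)%g; split; [by rewrite !groupM | | by rewrite a3 eq_sym].
  by do 2!apply: gal_adjoin => //.
split.
  by exists Z; split; [by [] | do 3!apply: gal_adjoin => // | by rewrite Zt1 eq_sym].
split=> //; exists (X * Z * X)%g; split; [by rewrite !groupM | | by rewrite b5 eq_sym].
by do 4!apply: gal_adjoin => //.
Qed.

End DwedgeDRelations.

Section G2RelationsInGalois.
Variables (F : fieldType) (L : splittingFieldType F) (r s1 s2 t1 t2 d m m' : L).
Local Notation gal := (gal_of (fullv : {vspace L})).
Hypothesis gen : <<1 & [:: r; s1; s2; t1; t2; d]>>%VS = {:L}%VS.
Variables X Y Z : gal.
Hypothesis DX : map X [:: r; s1; s2; t1; t2] = [:: - r; s2; s1; t2; t1].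
Hypothesis DY : map Y [:: r; s1; s2; t1; t2] = [:: r; - s1; s2; t1; t2].
Hypothesis DZ : map Z [:: r; s1; s2; t1; t2] = [:: r; s1; s2; - t1; t2].
Hypotheses (nzm : m != 0) (nzm' : m' != 0).
Hypothesis Xm : map X [:: m; m'] = [:: m'; m].
Hypothesis Ym : map Y [:: m; m'] = [:: m^-1; m'].
Hypothesis Zm : map Z [:: m; m'] = [:: m; - m'].
Hypotheses (Xd : X d = d \/ X d = - d) (Yd : Y d = d * m) (Zd : Z d = d \/ Z d = - d).

(* [m] is [t2 / (1 + s1)] up to sign, and [m'] is its image under [X]. *)
Lemma G2_relations_gal :
  G2_relations X Y Z /\
  map [~ Y, [~ X, Z]]%g [:: r; s1; s2; t1; t2; d] = [:: r; s1; s2; t1; t2; - d].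
Proof.
case: DX => Xr Xs1 Xs2 Xt1 Xt2; case: DY => Yr Ys1 Ys2 Yt1 Yt2.
case: DZ => Zr Zs1 Zs2 Zt1 Zt2; case: Xm => Xm1 Xm2; case: Ym => Ym1 Ym2; case: Zm => Zm1 Zm2.
pose tX := (Xr, Xs1, Xs2, Xt1, Xt2, Xm1, Xm2).
pose tY := (Yr, Ys1, Ys2, Yt1, Yt2, Ym1, Ym2, Yd).
pose tZ := (Zr, Zs1, Zs2, Zt1, Zt2, Zm1, Zm2).
have mV : m * m^-1 = 1 by apply: mulfV.
have X2 : (X ^+ 2 = 1)%g.
  apply: (gal_eq_map gen); rewrite /= !gal_id expgS expg1 !gal_mul.
  by case: Xd => e; do 2!rewrite ?tX ?e ?rmorphN /= ?opprK.
have Z2 : (Z ^+ 2 = 1)%g.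
  apply: (gal_eq_map gen); rewrite /= !gal_id expgS expg1 !gal_mul.
  by case: Zd => e; do 2!rewrite ?tZ ?e ?rmorphN /= ?opprK.
have Y2 : (Y ^+ 2 = 1)%g.
  apply: (gal_eq_map gen); rewrite /= !gal_id expgS expg1 !gal_mul.
  by do 2!rewrite ?tY ?rmorphN ?rmorphM /= ?opprK; rewrite -mulrA mV mulr1.
(* The values at [m] and [m'] are recorded too: they enter the later commutators through the value
   at [d]. *)
have DP : map [~ X, Y]%g [:: r; s1; s2; t1; t2; d; m; m'] =
    [:: r; - s1; - s2; t1; t2; d * m * m'; m^-1; m'^-1].
  rewrite commg_invol //= !gal_mul.
  by case: Xd => e; do 5!rewrite ?tX ?tY ?e ?rmorphN ?rmorphM ?fmorphV /= ?mulNr ?opprK.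
have DQ : map [~ X, Z]%g [:: r; s1; s2; t1; t2; d; m; m'] =
    [:: r; s1; s2; - t1; - t2; d; - m; - m'].
  rewrite commg_invol //= !gal_mul.
  by case: Xd => e; case: Zd => e'; do 4!rewrite ?tX ?tZ ?e ?e' ?rmorphN /= ?opprK.
have YZ : ([~ Y, Z] = 1)%g.
  apply: (gal_eq_map gen); rewrite /= !gal_id commg_invol // !gal_mul.
  case: Zd => e; do 4!rewrite ?tY ?tZ ?e ?rmorphN ?rmorphM ?fmorphV /= ?mulNr ?opprK;
    by rewrite -mulrA mV mulr1.
rewrite /G2_relations YZ; move: [~ X, Y]%g [~ X, Z]%g DP DQ.
move=> P Q [Pr Ps1 Ps2 Pt1 Pt2 Pd Pm Pm'] [Qr Qs1 Qs2 Qt1 Qt2 Qd Qm Qm'].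
pose tP := (Pr, Ps1, Ps2, Pt1, Pt2, Pd, Pm, Pm').
pose tQ := (Qr, Qs1, Qs2, Qt1, Qt2, Qd, Qm, Qm').
have P2 : (P ^+ 2 = 1)%g.
  apply: (gal_eq_map gen); rewrite /= !gal_id expgS expg1 !gal_mul.
  do 2!rewrite ?tP ?rmorphN ?rmorphM /= ?opprK; congr [:: _; _; _; _; _; _].
  by field; rewrite nzm nzm'.
have Q2 : (Q ^+ 2 = 1)%g.
  apply: (gal_eq_map gen); rewrite /= !gal_id expgS expg1 !gal_mul.
  by do 2!rewrite ?tQ ?rmorphN /= ?opprK.
(* [Y] multiplies [d] by [m], while [Q] fixes [d] and negates [m]; hence the sign on [d]. *)
have DW : map [~ Y, Q]%g [:: r; s1; s2; t1; t2; d; m; m'] =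
    [:: r; s1; s2; t1; t2; - d; m; m'].
  rewrite commg_invol //= !gal_mul.
  do 4!rewrite ?tY ?tQ ?rmorphN ?rmorphM ?fmorphV /= ?opprK ?invrK ?invrN ?opprK.
  by congr [:: _; _; _; _; _; _; _; _]; field; rewrite nzm.
have W' : ([~ Y, Q] = [~ Z, P])%g.
  apply: (gal_eq_map gen) => /=; case: DW => -> -> -> -> -> -> _ _.
  rewrite commg_invol //= !gal_mul.
  case: Zd => e; do 4!rewrite ?tZ ?tP ?e ?rmorphN ?rmorphM ?fmorphV /= ?opprK ?invrN ?opprK;
  by congr [:: _; _; _; _; _; _]; field; rewrite nzm nzm'.
split; last by rewrite /=; case: DW => -> -> -> -> -> -> _ _.
rewrite -W' P2 Q2; move: [~ Y, Q]%g DW => W [Wr Ws1 Ws2 Wt1 Wt2 Wd Wm Wm'].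
pose tW := (Wr, Ws1, Ws2, Wt1, Wt2, Wd, Wm, Wm').
have W2 : (W ^+ 2 = 1)%g.
  apply: (gal_eq_map gen); rewrite /= !gal_id expgS expg1 !gal_mul.
  by do 2!rewrite ?tW ?rmorphN /= ?opprK.
have WX : ([~ W, X] = 1)%g.
  apply/eqP/commgP; apply: (gal_eq_map gen); rewrite /= !gal_mul.
  by case: Xd => e; do 2!rewrite ?tW ?tX ?e ?rmorphN /= ?opprK.
have WY : ([~ W, Y] = 1)%g.
  apply/eqP/commgP; apply: (gal_eq_map gen); rewrite /= !gal_mul.
  by do 2!rewrite ?tW ?tY ?rmorphN ?rmorphM /= ?mulNr.
have WZ : ([~ W, Z] = 1)%g.
  apply/eqP/commgP; apply: (gal_eq_map gen); rewrite /= !gal_mul.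
  by case: Zd => e; do 2!rewrite ?tW ?tZ ?e ?rmorphN /= ?opprK.
by rewrite W2 WX WY WZ.
Qed.
End G2RelationsInGalois.

Lemma moved_along_rcons (F : fieldType) (L : splittingFieldType F)
    (H : {set gal_of (fullv : {vspace L})})
    (K : {subfield L}) xs x :
    moved_along H K xs ->
    (exists s, [/\ s \in H, s \in 'Gal({:L} / <<K & xs>>)%g & s x != x]) ->
  moved_along H K (rcons xs x).
Proof.
elim: xs K => [|y xs IHxs] K /=; last first.
  by case=> mv /(IHxs <<K; y>>%AS) mv' H'; split=> //; apply: mv'; rewrite -adjoin_cons.
by move=> _ [s [Hs sK sx]]; split=> //; exists s; split=> //; move: sK; rewrite Fadjoin_nil.
Qed.

Section Realization.
Variables (F : fieldType) (a p q : F).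
Hypothesis char_ne2 : (2%:R : F) != 0.
Local Notation b := (p ^+ 2 - a * q ^+ 2).
Local Notation c := ((1 - p) ^+ 2 - a * q ^+ 2).
Hypotheses (nza : a != 0) (nzb : b != 0) (nzc : c != 0).
Hypothesis indep : indep_mod_sq3 a b c.

Lemma DwedgeD_realizable : @has_galois_ext F (fun L G => isog_DwedgeD G).
Proof.
have [L [r [s1 [s2 [t1 [t2 [eqs gen galL]]]]]]] := five_roots_field a p q char_ne2.
exists L; split=> //.
have [nzr nzs1 nzs2 nzt1 nzt2] := five_roots_neq0 nza nzb nzc eqs.
have [X [Y [Z [DX DY DZ]]]] := acts_generators char_ne2 galL nza nzb nzc indep eqs.
have [rel w1] := DwedgeD_relations gen DX DY DZ.
have np (x : L) : x != 0 -> x != - x by apply: (neq_opp char_ne2).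
have mv := DwedgeD_moved DX DY DZ (np _ nzr) (np _ nzs1) (np _ nzs2) (np _ nzt1) (np _ nzt2).
have [<- card] := full_gal_moved_along galL (five_roots_tower eqs) gen mv.
exact: gen3_DwedgeD.
Qed.

Lemma G2_realizable : @has_galois_ext F (fun L G => isog_G2 G).
Proof.
have [L [r [s1 [s2 [t1 [t2 [d [eqs Dd gen galL]]]]]]]] := six_roots_field char_ne2 nzc.
exists L; split=> //.
have [nzr nzs1 nzs2 nzt1 nzt2] := five_roots_neq0 nza nzb nzc eqs.
have [nz1 nz1' nz2 nz2'] := five_roots_pm1_neq0 nza nzb nzc eqs.
have nzd : d != 0 by rewrite -sqrf_eq0 Dd mulf_neq0.
have [X [Y [Z [DX DY DZ]]]] := acts_generators char_ne2 galL nza nzb nzc indep eqs.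
have np (x : L) : x != 0 -> x != - x by apply: (neq_opp char_ne2).
have mv := DwedgeD_moved DX DY DZ (np _ nzr) (np _ nzs1) (np _ nzs2) (np _ nzt1) (np _ nzt2).
have [_ _ _ Dt1 Dt2] := eqs.
have [[Xr Xs1 Xs2 Xt1 Xt2] [Yr Ys1 Ys2 Yt1 Yt2] [Zr Zs1 Zs2 Zt1 Zt2]] := And3 DX DY DZ.
have Xd : X d = d \/ X d = - d.
  have: (X d) ^+ 2 == d ^+ 2.
    by rewrite -rmorphXn /= Dd rmorphM !rmorphD rmorph1 /= Xs1 Xs2 mulrC.
  by rewrite eqf_sqr => /orP[] /eqP; [left|right].
have Zd : Z d = d \/ Z d = - d.
  have: (Z d) ^+ 2 == d ^+ 2.
    by rewrite -rmorphXn /= Dd rmorphM !rmorphD rmorph1 /= Zs1 Zs2.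
  by rewrite eqf_sqr => /orP[] /eqP; [left|right].
have [e De] : exists e : bool, Y d = d * ((-1) ^+ e * (t2 / (1 + s1))).
  have: (Y d) ^+ 2 == (d * (t2 / (1 + s1))) ^+ 2.
    rewrite -rmorphXn /= Dd rmorphM !rmorphD rmorph1 /= Ys1 Ys2 !exprMn Dd Dt2.
    by apply/eqP; field; rewrite nz1.
  by rewrite eqf_sqr => /orP[] /eqP->; [exists false | exists true];
    rewrite ?mul1r // mulN1r mulrN.
have e2 : (-1) ^+ e * (-1) ^+ e = 1 :> L by rewrite -expr2 sqrr_sign.
have nze : (-1) ^+ e != 0 :> L by rewrite signr_eq0.
(* The undetermined sign of [Y d] is absorbed into [m], so that [Y d = d * m] exactly; [m'] takes
   the same sign to remain the image of [m] under [X]. [Y] inverts [m] because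
   [(1 - s1) * (1 + s1) = t2 ^ 2]. *)
pose m := (-1) ^+ e * (t2 / (1 + s1)) : L; pose m' := (-1) ^+ e * (t1 / (1 + s2)) : L.
have nzm : m != 0 by rewrite !mulf_neq0 ?invr_eq0.
have nzm' : m' != 0 by rewrite !mulf_neq0 ?invr_eq0.
have Xm : map X [:: m; m'] = [:: m'; m].
  by rewrite /= /m /m' !rmorphM !fmorphV !rmorphD rmorph_sign rmorph1 /= Xt1 Xt2 Xs1 Xs2.
have Zm : map Z [:: m; m'] = [:: m; - m'].
  rewrite /= /m /m' !rmorphM !fmorphV !rmorphD rmorph_sign rmorph1 /= Zt1 Zt2 Zs1 Zs2.
  by rewrite mulNr mulrN.
have Ym : map Y [:: m; m'] = [:: m^-1; m'].
  rewrite /= /m /m' !rmorphM !fmorphV !rmorphD rmorph_sign rmorph1 /= Yt1 Yt2 Ys1 Ys2.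
  congr [:: _; _]; apply: (mulIf nzm); rewrite mulVf // /m mulrACA e2 mul1r.
  by rewrite mulrACA -expr2 Dt2; field; rewrite nz1 nz1'.
have [rel W] := G2_relations_gal gen DX DY DZ nzm nzm' Xm Ym Zm Xd De Zd.
(* [[~ Y, [~ X, Z]]] fixes the five roots and negates [d]: it is the sixth witness, which raises the
   order to 64. *)
have mv' : moved_along (gen3 X Y Z) 1%VS [:: r; s1; s2; t1; t2; d].
  apply: (@moved_along_rcons _ _ _ _ [:: r; s1; s2; t1; t2]) mv _.
  exists [~ Y, [~ X, Z]]%g; move: W; rewrite /= => -[Wr Ws1 Ws2 Wt1 Wt2 Wd].
  have [HX HY HZ] := mem_gen3 X Y Z; split; first by rewrite !groupR.
    apply: gal_adjoin_seq; first exact: mem_gal1.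
    by move=> x; rewrite !inE => /or4P[||| /orP[]] /eqP->.
  by rewrite Wd eq_sym np.
have [<- card] := full_gal_moved_along galL (six_roots_tower eqs Dd) gen mv'.
exact: G2_isoGrp.
Qed.

End Realization.

(** * Square classes and norms *)

Section SquareClassArithmetic.
Variable F : fieldType.
Hypothesis char_ne2 : (2%:R : F) != 0.
Implicit Types (a b c x y z u v : F) (e : bool).

Lemma nz_squareM x y : nz_square x -> nz_square y -> nz_square (x * y).
Proof.
move=> [u [nzu ->]] [v [nzv ->]]; exists (u * v); split; first exact: mulf_neq0.
by rewrite exprMn.
Qed.

Lemma nz_squareMr x z : z != 0 -> nz_square (x * z ^+ 2) -> nz_square x.
Proof.
move=> nzz [u [nzu Du]]; exists (u / z); split; first by rewrite mulf_neq0 ?invr_eq0.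
by rewrite exprMn -Du exprVn mulfK ?expf_neq0.
Qed.

Lemma eq_mod_sqE x y : x != 0 -> y != 0 -> eq_mod_sq x y <-> nz_square (x * y).
Proof.
move=> nzx nzy; split=> [[z [nzz ->]]|[w [nzw Dw]]].
  by exists (y * z); split; [rewrite mulf_neq0 | ring].
exists (w / y); split; first by rewrite mulf_neq0 ?invr_eq0.
by rewrite exprMn -Dw; field.
Qed.

Lemma expr_addb x e e' : x ^+ e * x ^+ e' = x ^+ (e (+) e') * (x ^+ (e && e')) ^+ 2.
Proof. by case: e e' => [] []; rewrite /= ?expr1 ?expr0; ring. Qed.

Lemma indep_mod_sq3I x y z :
    ~ nz_square x -> (forall e, ~ nz_square (x ^+ e * y)) ->
    (forall e e', ~ nz_square (x ^+ e * y ^+ e' * z)) ->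
  indep_mod_sq3 x y z.
Proof.
move=> nx ny nz e1 e2 [_|]; first exact: nz.
rewrite orbF mulr1; case: e2 => [_|]; first exact: ny.
by rewrite orbF mulr1; case: e1.
Qed.

Lemma indep_mod_sq3_scale a b c u v : u != 0 -> v != 0 ->
  indep_mod_sq3 a b c -> indep_mod_sq3 a (u ^+ 2 * b) (v ^+ 2 * c).
Proof.
move=> nzu nzv ind e1 e2 e3 e sq; apply: (ind e1 e2 e3 e).
apply: (@nz_squareMr _ (u ^+ e2 * v ^+ e3)); first by rewrite mulf_neq0 ?expf_neq0.
by move: sq; case: e1 e2 e3 {e} => [] [] []; congr nz_square; ring.
Qed.

Lemma sqclass_card_ge_fin (I : finType) (i0 : I) (f : I -> F) (S : F -> Prop) :
    (forall i, S (f i)) -> (forall i j, i != j -> ~ eq_mod_sq (f i) (f j)) ->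
  sqclass_card_ge S #|I|.
Proof.
move=> Sf injf; exists (mkseq (fun k => f (nth i0 (enum I) k)) #|I|).
rewrite size_mkseq; split=> //; split=> [i lti|i j lti ltj ij].
  by rewrite nth_mkseq.
by rewrite !nth_mkseq //; apply: injf; rewrite nth_uniq ?enum_uniq // -cardE.
Qed.

(** Used to choose a norm outside the span of those already chosen: two of the [n] classes meeting
    the same [t] would coincide. *)
Lemma sqclass_pigeonhole (S : F -> Prop) n (T : seq F) :
    sqclass_card_ge S n -> (size T < n)%N -> {in T, forall t, t != 0} ->
    (forall y, S y -> y != 0) ->
  exists y, S y /\ {in T, forall t, ~ nz_square (y * t)}.
Proof.
case=> s [sz [Ss inj]] ltT nzT nzS; apply: NNPP => no.
have hit (i : 'I_n) : exists k : 'I_(size T), nz_square (nth 0 s i * nth 0 T k).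
  apply: NNPP => nk; apply: no; exists (nth 0 s i); split; first exact: Ss.
  move=> t Tt sq; apply: nk; have lt : (index t T < size T)%N by rewrite index_mem.
  by exists (Ordinal lt); rewrite /= nth_index.
have [f Hf] := fin_all_exists hit.
have /injectivePn[i [j ij fij]] : ~~ injectiveb f.
  by apply/negP => /injectiveP /leq_card; rewrite !card_ord leqNgt ltT.
case: (inj i j (ltn_ord _) (ltn_ord _) ij).
apply/eq_mod_sqE; [exact/nzS/Ss|exact/nzS/Ss|].
have := nz_squareM (Hf i) (Hf j); rewrite -fij mulrACA -expr2.
by apply: nz_squareMr; apply/nzT/mem_nth.
Qed.

Local Notation N a := (DF2 1 (- a)).

Lemma norm_neq0 a y : N a y -> y != 0. Proof. by case. Qed.

Lemma normM a x y : N a x -> N a y -> N a (x * y).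
Proof.
move=> [nzx [x1 [x2 Dx]]] [nzy [y1 [y2 Dy]]]; split; first exact: mulf_neq0.
(* Coordinates of [(x1 + x2 r) (y1 + y2 r)] with [r ^ 2 = a]. *)
by exists (x1 * y1 + a * x2 * y2), (x1 * y2 + x2 * y1); rewrite Dx Dy; ring.
Qed.

Lemma norm_sq a x : x != 0 -> N a (x ^+ 2).
Proof. by move=> nzx; split; [exact: expf_neq0 | exists x, 0; ring]. Qed.

Lemma normX a x e : N a x -> N a (x ^+ e).
Proof. by case: e => // _; have := norm_sq a (oner_neq0 F); rewrite expr1n. Qed.

Lemma norm_opp a : a != 0 -> N a (- a).
Proof. by move=> nza; split; [rewrite oppr_eq0 | exists 0, 1; ring]. Qed.

Lemma norm_cancel a x y : x != 0 -> N a y -> nz_square (x * y) -> N a x.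
Proof.
move=> nzx Ny [w [nzw Dw]]; have nzy := norm_neq0 Ny.
have -> : x = y * (w / y) ^+ 2 by rewrite exprMn -Dw; field.
by apply: normM => //; apply: norm_sq; rewrite mulf_neq0 ?invr_eq0.
Qed.

Lemma sum_two_squares_norm a : ~ nz_square a -> a != 0 -> DF2 1 1 a -> N a (-1).
Proof.
move=> nsq nza [_ [x [y Da]]]; have nzy : y != 0.
  apply/negP => /eqP y0; apply: nsq; exists x; split; last by rewrite Da y0; ring.
  by apply: contraNneq nza => x0; rewrite Da x0 y0; apply/eqP; ring.
split; first by rewrite oppr_eq0 oner_neq0.
by exists (x / y), y^-1; rewrite Da; field.
Qed.

Lemma norm_self_sum_two_squares a : a != 0 -> N a a -> DF2 1 1 a.
Proof.
move=> nza [_ [x [y Da]]]; split=> //.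
have Dx : a * (1 + y ^+ 2) = x ^+ 2 by rewrite mulrDr mulr1 {1}Da; ring.
have [y1|nz] := eqVneq (1 + y ^+ 2) 0.
  (* here [- 1] is a square and every element is a sum of two squares *)
  exists ((a + 1) / 2%:R), (y * (a - 1) / 2%:R).
  have -> : 1 * ((a + 1) / 2%:R) ^+ 2 + 1 * (y * (a - 1) / 2%:R) ^+ 2 =
     a + (1 + y ^+ 2) * ((a - 1) / 2%:R) ^+ 2 by field.
  by rewrite y1 mul0r addr0.
exists (x / (1 + y ^+ 2)), (x * y / (1 + y ^+ 2)).
have -> : 1 * (x / (1 + y ^+ 2)) ^+ 2 + 1 * (x * y / (1 + y ^+ 2)) ^+ 2 =
   x ^+ 2 / (1 + y ^+ 2) by field.
by rewrite -Dx mulfK.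
Qed.

Lemma norm_card8 a x y z : N a x -> N a y -> N a z ->
  indep_mod_sq3 x y z -> sqclass_card_ge (N a) 8.
Proof.
move=> Nx Ny Nz ind.
have -> : 8%N = #|{: bool * bool * bool}| by rewrite !card_prod !card_bool.
pose f (i : bool * bool * bool) := x ^+ i.1.1 * y ^+ i.1.2 * z ^+ i.2.
have Nf i : N a (f i) by do 2?apply: normM; apply: normX.
apply: (@sqclass_card_ge_fin _ (true, true, true) f) => // i j ij.
move/eq_mod_sqE => /(_ (norm_neq0 (Nf i)) (norm_neq0 (Nf j))).
rewrite /f mulrACA [X in X * _]mulrACA !expr_addb.
move: i j ij => [[i1 i2] i3] [[j1 j2] j3] /= ij sq.
apply: (ind (i1 (+) j1) (i2 (+) j2) (i3 (+) j3)).
  by case: i1 i2 i3 j1 j2 j3 ij {sq} => [] [] [] [] [] [].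
apply: (@nz_squareMr _ (x ^+ (i1 && j1) * y ^+ (i2 && j2) * z ^+ (i3 && j3))).
  by rewrite !mulf_neq0 ?expf_neq0 ?(norm_neq0 Nx) ?(norm_neq0 Ny) ?(norm_neq0 Nz).
by move: sq; congr nz_square; ring.
Qed.

Lemma norm_card4 a y z : N a y -> N a z -> indep_mod_sq3 a y z ->
  sqclass_card_ge (N a) 4.
Proof.
move=> Ny Nz ind.
have -> : 4%N = #|{: bool * bool}| by rewrite card_prod card_bool.
pose f (i : bool * bool) := y ^+ i.1 * z ^+ i.2.
have Nf i : N a (f i) by apply: normM; apply: normX.
apply: (@sqclass_card_ge_fin _ (true, true) f) => // i j ij.
move/eq_mod_sqE => /(_ (norm_neq0 (Nf i)) (norm_neq0 (Nf j))).
rewrite /f mulrACA !expr_addb; move: i j ij => [i2 i3] [j2 j3] /= ij sq.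
apply: (ind false (i2 (+) j2) (i3 (+) j3)).
  by case: i2 i3 j2 j3 ij {sq} => [] [] [] [].
apply: (@nz_squareMr _ (y ^+ (i2 && j2) * z ^+ (i3 && j3))).
  by rewrite !mulf_neq0 ?expf_neq0 ?(norm_neq0 Ny) ?(norm_neq0 Nz).
by move: sq; congr nz_square; ring.
Qed.

(** With fewer than eight classes every norm lies in the span of [b] and [c], which has four. If
    moreover [a] were a sum of two squares, both [-1] and [- a] would be norms, and their product
    would put [a] in that span. *)
Lemma independent_norms_card a b c :
    a != 0 -> N a b -> N a c -> indep_mod_sq3 a b c ->
  sqclass_card_ge (N a) 8 \/ (sqclass_card_eq (N a) 4 /\ ~ DF2 1 1 a).
Proof.
move=> nza Nb Nc ind; have [|no8] := classic (sqclass_card_ge (N a) 8); [by left | right].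
have span x : N a x -> exists e e', nz_square (b ^+ e * c ^+ e' * x).
  move=> Nx; apply: NNPP => no; apply: no8; apply: (norm_card8 Nb Nc Nx).
  apply: indep_mod_sq3I => [|e|e e' sq].
  - by have := ind false true false isT; rewrite mul1r mulr1 expr1.
  - by have := ind false e true; rewrite mul1r expr1 orbT; apply.
  - by apply: no; exists e, e'.
have nsqa : ~ nz_square a by have := ind true false false isT; rewrite !mulr1 expr1.
split; first split; first exact: norm_card4 Nb Nc ind.
  move=> ge5; have [||x|x [Nx nx]] := @sqclass_pigeonhole _ _ [:: 1; b; c; b * c] ge5.
  - by [].
  - move=> t; rewrite !inE => /or4P[] /eqP->; rewrite ?oner_neq0 ?mulf_neq0 //;
    by rewrite ?(norm_neq0 Nb) ?(norm_neq0 Nc).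
  - exact: norm_neq0.
  have [e [e']] := span x Nx; rewrite mulrC; apply: nx.
  by case: e e' => [] []; rewrite ?expr1 ?expr0 ?mul1r ?mulr1 !inE eqxx ?orbT.
move=> /(sum_two_squares_norm nsqa nza) /span[e [e' sq]].
have [f [f' sq']] := span _ (norm_opp nza).
apply: (ind true (e (+) f) (e' (+) f')) => //.
apply: (@nz_squareMr _ (b ^+ (e && f) * c ^+ (e' && f'))).
  by rewrite mulf_neq0 ?expf_neq0 ?(norm_neq0 Nb) ?(norm_neq0 Nc).
have := nz_squareM sq sq'; rewrite mulrACA [X in X * _]mulrACA !expr_addb.
by congr nz_square; rewrite expr1; ring.
Qed.

(** Eight classes leave room to avoid first the span of [a], then that of [a] and [b]. With only
    four, [a] itself is not a norm, so it lies outside the group of norms and independence of [b]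
    and [c] alone suffices. *)
Lemma norm_card_independent a : a != 0 -> ~ nz_square a ->
    sqclass_card_ge (N a) 8 \/ (sqclass_card_eq (N a) 4 /\ ~ DF2 1 1 a) ->
  exists b c, [/\ N a b, N a c & indep_mod_sq3 a b c].
Proof.
move=> nza nsqa; case=> [ge8|[[ge4 _] na2]].
  have [||x|b [Nb nb]] := @sqclass_pigeonhole _ _ [:: 1; a] ge8; rewrite //.
  - by move=> t; rewrite !inE => /orP[] /eqP->; rewrite ?oner_neq0.
  - exact: norm_neq0.
  have nzb := norm_neq0 Nb.
  have [||x|c [Nc nc]] := @sqclass_pigeonhole _ _ [:: 1; a; b; a * b] ge8; rewrite //.
  - by move=> t; rewrite !inE => /or4P[] /eqP->; rewrite ?oner_neq0 ?mulf_neq0.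
  - exact: norm_neq0.
  exists b, c; split=> //; apply: indep_mod_sq3I => // [e|e e'].
    rewrite mulrC; apply: nb; case: e; rewrite ?expr1 ?expr0 !inE eqxx ?orbT //.
  rewrite mulrC; apply: nc.
  by case: e e' => [] []; rewrite ?expr1 ?expr0 ?mul1r ?mulr1 !inE eqxx ?orbT.
have nNa : ~ N a a by move/(norm_self_sum_two_squares nza).
have [||x|b [Nb nb]] := @sqclass_pigeonhole _ _ [:: 1] ge4; rewrite //.
- by move=> t; rewrite !inE => /eqP->; rewrite oner_neq0.
- exact: norm_neq0.
have nzb := norm_neq0 Nb.
have [||x|c [Nc nc]] := @sqclass_pigeonhole _ _ [:: 1; b] ge4; rewrite //.
- by move=> t; rewrite !inE => /orP[] /eqP->; rewrite ?oner_neq0.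
- exact: norm_neq0.
exists b, c; split=> //; apply: indep_mod_sq3I => // [[]|[] e'].
- by move=> sq; apply: nNa; apply: norm_cancel Nb sq.
- by rewrite expr0 mulrC; apply: nb; rewrite inE.
- rewrite -mulrA => sq; apply: nNa; apply: norm_cancel sq => //.
  by apply: normM => //; apply: normX.
- rewrite mul1r mulrC; apply: nc.
  by case: e'; rewrite ?expr1 ?expr0 !inE eqxx ?orbT.
Qed.

Lemma norm_rescale a b c : a != 0 -> N a b -> N a c -> indep_mod_sq3 a b c ->
  exists p q, [/\ p ^+ 2 - a * q ^+ 2 != 0, (1 - p) ^+ 2 - a * q ^+ 2 != 0 &
    indep_mod_sq3 a (p ^+ 2 - a * q ^+ 2) ((1 - p) ^+ 2 - a * q ^+ 2)].
Proof.
move=> nza [nzb [x1 [x2 Db]]] [nzc [y1 [y2 Dc]]] ind.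
have nsq x k : k != 0 -> ~ nz_square k -> k = 1 * x ^+ 2 + - a * 0 ^+ 2 -> False.
  move=> nzk nsqk Dk; apply: nsqk; exists x; split; last by rewrite Dk; ring.
  by apply: contraNneq nzk => x0; rewrite Dk x0; apply/eqP; ring.
have nx2 : x2 != 0.
  apply/negP => /eqP x20; apply: (nsq x1 b nzb); last by rewrite Db x20.
  by have := ind false true false isT; rewrite mul1r mulr1 expr1.
have ny2 : y2 != 0.
  apply/negP => /eqP y20; apply: (nsq y1 c nzc); last by rewrite Dc y20.
  by have := ind false false true isT; rewrite !mul1r expr1.
(* A zero determinant would make [x1 + x2 r] and [y1 - y2 r] proportional over [F], and [b * c] a
   square. *)
have nzD : x1 * y2 + y1 * x2 != 0.
  apply/negP => /eqP D0; apply: (ind false true true isT).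
  exists (b * (y2 / x2)); split; first by rewrite !mulf_neq0 ?invr_eq0.
  have Dy1 : y1 = - (x1 * y2) / x2.
    by apply: (mulIf nx2); rewrite mulfVK //; apply/eqP; rewrite -subr_eq0 opprK addrC D0.
  by rewrite mul1r !expr1 Dc Dy1 Db; field.
(* The solution of [u (x1 + x2 r) + v (y1 - y2 r) = 1] by Cramer's rule. *)
pose u := y2 / (x1 * y2 + y1 * x2); pose v := x2 / (x1 * y2 + y1 * x2).
have nzu : u != 0 by rewrite mulf_neq0 ?invr_eq0.
have nzv : v != 0 by rewrite mulf_neq0 ?invr_eq0.
exists (u * x1), (u * x2).
have -> : (u * x1) ^+ 2 - a * (u * x2) ^+ 2 = u ^+ 2 * b by rewrite Db; ring.
have -> : (1 - u * x1) ^+ 2 - a * (u * x2) ^+ 2 = v ^+ 2 * c.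
  by rewrite Dc /u /v; field.
by split; [rewrite mulf_neq0 ?expf_neq0 | rewrite mulf_neq0 ?expf_neq0 |
  apply: indep_mod_sq3_scale].
Qed.

End SquareClassArithmetic.

(** * Split quaternion algebras *)

Section QuaternionSplitting.
Variable F : fieldType.
Hypothesis char_ne2 : (2%:R : F) != 0.
Implicit Types (a b : F).

Definition mx2 (m00 m01 m10 m11 : F) : 'M[F]_2 :=
  \matrix_(i, j) if i == 0 then (if j == 0 then m00 else m01)
                 else (if j == 0 then m10 else m11).

Lemma eq_mx2 (A B : 'M[F]_2) :
  A 0 0 = B 0 0 -> A 0 1 = B 0 1 -> A 1 0 = B 1 0 -> A 1 1 = B 1 1 -> A = B.
Proof.
move=> e00 e01 e10 e11; apply/matrixP => i j.
have E (k : 'I_2) : k = 0 \/ k = 1.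
  by case: k => [[|[|]] // ?]; [left | right]; apply: val_inj.
by case: (E i) (E j) => -> [] ->.
Qed.

Lemma norm_quat_split a b : a != 0 -> DF2 1 (- a) b -> quat_split a b.
Proof.
move=> nza [nzb [p [q Db]]].
(* The action on [F[r]], [r ^ 2 = a], in the basis [1, r]: [i] is multiplication by [r] and [j]
   sends [z] to [(p + q r)] times the conjugate of [z], so that [j ^ 2 = p ^ 2 - a q ^ 2 = b]. *)
pose phi (x : quat F) := let: (x0, x1, x2, x3) := x in
  mx2 (x0 + p * x2 + a * q * x3) (a * (x1 - q * x2 - p * x3))
      (x1 + q * x2 + p * x3) (x0 - p * x2 - a * q * x3).
(* On the image of [phi], [u = p x2 + a q x3] and [v = q x2 + p x3], a linear system of determinant
   [b]. *)
pose psi (A : 'M[F]_2) : quat F :=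
  let u := (A 0 0 - A 1 1) / 2%:R in let v := (A 1 0 - A 0 1 / a) / 2%:R in
  ((A 0 0 + A 1 1) / 2%:R, (A 1 0 + A 0 1 / a) / 2%:R,
   (p * u - a * q * v) / b, (p * v - q * u) / b).
rewrite mul1r in Db; have nzb' : p ^+ 2 + - a * q ^+ 2 != 0 by rewrite -Db.
exists phi; split.
  exists psi.
    move=> [[[x0 x1] x2] x3]; rewrite /psi /phi !mxE /= Db.
    by congr (_, _, _, _); field; rewrite ?char_ne2 ?nza ?nzb'.
  by move=> A; apply: eq_mx2; rewrite /phi /psi !mxE /= Db; field;
    rewrite ?char_ne2 ?nza ?nzb'.
split=> [x y|]; first by move: x y => [[[x0 x1] x2] x3] [[[y0 y1] y2] y3];
  apply: eq_mx2; rewrite /= !mxE /=; ring.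
split=> [k x|]; first by move: x => [[[x0 x1] x2] x3];
  apply: eq_mx2; rewrite /= !mxE /=; ring.
split=> [|x y]; first by apply: eq_mx2; rewrite /= !mxE /=; ring.
move: x y => [[[x0 x1] x2] x3] [[[y0 y1] y2] y3].
by apply: eq_mx2; rewrite /= !mxE !big_ord_recl big_ord0 !mxE /= Db; ring.
Qed.

Lemma quat_split_norm a b :
  a != 0 -> ~ nz_square a -> b != 0 -> quat_split a b -> DF2 1 (- a) b.
Proof.
move=> nza nsqa nzb [phi [[psi phiK psiK] [_ [phiZ [_ phiM]]]]]; split=> //.
have phi0 : phi (0, 0, 0, 0) = 0.
  by have := phiZ 0 (0, 0, 0, 0); rewrite /qscale !mul0r scale0r.
(* A nonzero nilpotent of M_2(F) pulls back to a quaternion of norm 0. *)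
pose e := psi (delta_mx 0 1).
have ee : qmul a b e e = (0, 0, 0, 0).
  apply: (can_inj phiK); rewrite phiM phi0 psiK.
  by rewrite mul_delta_mx_0.
have nze : e <> (0, 0, 0, 0).
  move=> e0; have : phi e = 0 by rewrite e0 phi0.
  by rewrite psiK => /matrixP/(_ 0 1)/eqP; rewrite !mxE !eqxx oner_eq0.
move: e ee nze => [[[x0 x1] x2] x3] [E0 E1 E2 E3] nze.
have x0z : x0 = 0.
  have [//|nz0] := eqVneq x0 0; case: nze.
  have z k : 2%:R * (x0 * k) = 0 -> k = 0.
    by move/eqP; rewrite !mulf_eq0 (negPf char_ne2) (negPf nz0) => /eqP.
  have x1z : x1 = 0 by apply: z; rewrite -E1; ring.
  have x2z : x2 = 0 by apply: z; rewrite -E2; ring.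
  have x3z : x3 = 0 by apply: z; rewrite -E3; ring.
  move: E0; rewrite x1z x2z x3z !(mulr0, addr0, subr0) => /eqP.
  by rewrite mulf_eq0 orbb (negPf nz0).
(* For a pure quaternion, [e ^ 2 = 0] says that [b] times the norm of [x2 + x3 r] is the norm of
   [x1 r], where [r ^ 2 = a]. *)
pose n := x2 ^+ 2 - a * x3 ^+ 2.
have Dn : b * n = - (a * x1 ^+ 2).
  apply/eqP; rewrite -addr_eq0 -E0 x0z /n; apply/eqP; ring.
have nzn : n != 0.
  apply: contra_notN nze => /eqP n0; move: Dn; rewrite n0 mulr0 => /esym/eqP.
  rewrite oppr_eq0 mulf_eq0 (negPf nza) sqrf_eq0 => /eqP x1z.
  have Dx2 : x2 ^+ 2 = a * x3 ^+ 2 by apply/eqP; rewrite -subr_eq0 -/n n0.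
  have x3z : x3 = 0.
    have [//|nz3] := eqVneq x3 0; case: nsqa; exists (x2 / x3).
    rewrite exprMn Dx2 exprVn mulfK ?expf_neq0 //; split=> //.
    by rewrite mulf_neq0 ?invr_eq0 // -sqrf_eq0 Dx2 mulf_neq0 ?expf_neq0.
  have x2z : x2 = 0.
    by apply/eqP; rewrite -sqrf_eq0 Dx2 x3z; apply/eqP; ring.
  by rewrite x0z x1z x2z x3z.
(* Up to sign, the coordinates of [x1 r / (x2 + x3 r)]. *)
exists (a * x1 * x3 / n), (x1 * x2 / n).
apply: (mulIf nzn); rewrite Dn /n; field; exact: nzn.
Qed.

End QuaternionSplitting.

(** * Degree of an extension by three square roots *)

Section SquareRootDegree.
Variable F : fieldType.
Hypothesis char_ne2 : (2%:R : F) != 0.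

Lemma dim_adjoin_sqrt3 (L : fieldExtType F) (a b c : F) (x y z : L) :
    x ^+ 2 = a%:A -> y ^+ 2 = b%:A -> z ^+ 2 = c%:A ->
  \dim <<1 & [:: x; y; z]>> = 8 <->
  [/\ x \notin (1%VS : {vspace L}), y \notin <<1; x>>%VS & z \notin <<<<1; x>>; y>>%VS].
Proof.
move=> Dx Dy Dz; rewrite !adjoin_cons Fadjoin_nil.
have alg1 k : k%:A \in (1%AS : {subfield L}) by rewrite rpredZ ?mem1v.
have x2 : x ^+ 2 \in (1%AS : {subfield L}) by rewrite Dx.
have y2 : y ^+ 2 \in <<1%AS; x>>%AS by rewrite Dy subvP_adjoin.
have z2 : z ^+ 2 \in <<<<1%AS; x>>%AS; y>>%AS by rewrite Dz; do 2!apply: subvP_adjoin.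
rewrite (dim_adjoin_sqrt z2) (dim_adjoin_sqrt y2) (dim_adjoin_sqrt x2) dimv1.
by split=> [|[/negPf-> /negPf-> /negPf->]] //; do 3!case: ifP => //.
Qed.

Lemma indep_deg_sqrt3 (a b c : F) :
  [/\ a != 0, b != 0 & c != 0] -> indep_mod_sq3 a b c -> deg_sqrt3 a b c 8.
Proof.
move=> nz ind.
have [L1 [f1 [f1k [x Dx]]]] := @adjoin_sqrt F F^o a%:A.
have [L2 [f2 [f2k [y Dy]]]] := @adjoin_sqrt F L1 b%:A.
have [L3 [f3 [f3k [z Dz]]]] := @adjoin_sqrt F L2 c%:A.
rewrite f1k in Dx; rewrite f2k in Dy; rewrite f3k in Dz.
have Dx3 : (f3 (f2 x)) ^+ 2 = a%:A by rewrite -!rmorphXn /= Dx f2k f3k.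
have Dy3 : (f3 y) ^+ 2 = b%:A by rewrite -!rmorphXn /= Dy f3k.
exists L3, (f3 (f2 x)), (f3 y), z; do 3!split=> //.
by apply/(dim_adjoin_sqrt3 Dx3 Dy3 Dz); apply: indep_sqrt_tower Dx3 Dy3 Dz.
Qed.

(** A square relation makes a monomial in the roots equal to plus or minus an element of [F]; its
    last root would then lie in the field generated by the earlier ones. *)
Lemma deg_sqrt3_indep (a b c : F) :
  deg_sqrt3 a b c 8 -> [/\ a != 0, b != 0 & c != 0] /\ indep_mod_sq3 a b c.
Proof.
case=> L [x [y [z [Dx [Dy [Dz]]]]]] /(dim_adjoin_sqrt3 Dx Dy Dz)[x1 yx zxy].
have nz0 (K : {subfield L}) (u : L) k : u ^+ 2 = k%:A -> u \notin K -> k != 0.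
  move=> Du; apply: contraNneq => k0.
  by move/eqP: Du; rewrite k0 scale0r sqrf_eq0 => /eqP->; rewrite rpred0.
have nz : [/\ a != 0, b != 0 & c != 0].
  split; [exact: (nz0 1%AS) Dx x1 | exact: (nz0 <<1%AS; x>>%AS) Dy yx |].
  exact: (nz0 <<<<1%AS; x>>%AS; y>>%AS) Dz zxy.
split=> // e1 e2 e3 e [f [nzf Df]].
have nzr (u : L) k : k != 0 -> u ^+ 2 = k%:A -> u != 0.
  by move=> nzk Du; rewrite -sqrf_eq0 Du scaler_eq0 negb_or nzk oner_neq0.
have [nzx nzy] : x != 0 /\ y != 0.
  by case: nz => nza nzb _; split; [apply: nzr Dx | apply: nzr Dy].
have in1 (K : {subfield L}) : x ^+ e1 * y ^+ e2 * z ^+ e3 \in K.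
  have : (x ^+ e1 * y ^+ e2 * z ^+ e3) ^+ 2 == (f%:A) ^+ 2.
    rewrite !exprMn -!exprM !(mulnC _ 2%N) !exprM Dx Dy Dz -!in_algE.
    by rewrite -!rmorphXn -!rmorphM /= Df.
  have fK : f%:A \in K by rewrite rpredZ ?mem1v.
  by rewrite eqf_sqr => /orP[] /eqP->; rewrite ?rpredN.
have xK (K : {subfield L}) : x \in <<K; x>>%AS by apply: memv_adjoin.
case: e3 e in1 {Df} => [_ /(_ <<<<1%AS; x>>%AS; y>>%AS)|].
  rewrite expr1 fpredMl ?(negPf zxy) //.
    rewrite rpredM // rpredX //; last exact: memv_adjoin.
    exact: subvP_adjoin.
  by rewrite mulf_neq0 ?expf_neq0.
rewrite orbF; case: e2 => [_ /(_ <<1%AS; x>>%AS)|].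
  rewrite expr1 mulr1 fpredMl ?(negPf yx) ?expf_neq0 //.
  by apply: rpredX; apply: memv_adjoin.
by rewrite orbF => -> /(_ 1%AS); rewrite expr1 !mulr1 (negPf x1).
Qed.

End SquareRootDegree.

(** * The cycle of implications, from (1) through (5) and back to (1) *)

Theorem theorem4p7 (F : fieldType) (char_ne2 : (2%:R : F) != 0) :
  [<-> (* (1) *) @has_galois_ext F (fun L G => isog_DwedgeD G);
       (* (2) *) @has_galois_ext F (fun L G => isog_G2 G);
       (* (3) *) exists a b c : F, deg_sqrt3 a b c 8 /\
                   quat_split a b /\ quat_split a c;
       (* (4) *) exists a b c : F, [/\ a != 0, b != 0 & c != 0] /\
                   [/\ ~ nz_square a, ~ nz_square b & ~ nz_square c] /\
                   indep_mod_sq3 a b c /\ DF2 1 (- a) b /\ DF2 1 (- a) c;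
       (* (5) *) exists a : F, a != 0 /\ ~ nz_square a /\
                   (sqclass_card_ge (DF2 1 (- a)) 8 \/
                    (sqclass_card_eq (DF2 1 (- a)) 4 /\ ~ DF2 1 1 a))].
Proof.
tfae.
(* The given extension only supplies [a], [b], [c]; the extension with group G2 is built afresh from
   them, with no claim that it contains the given one. *)
- case=> L [galL /DwedgeD_twin_klein/(twin_klein_norms char_ne2 galL)].
  case=> a [b [c [[nza nzb nzc] [ind [Nb Nc]]]]].
  have [p [q [nzb' nzc' ind']]] := norm_rescale nza Nb Nc ind.
  exact: G2_realizable nza nzb' nzc' ind'.
- case=> L [galL /G2_twin_klein/(twin_klein_norms char_ne2 galL)].
  case=> a [b [c [nz [ind [Nb Nc]]]]]; exists a, b, c; split.
    exact: indep_deg_sqrt3.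
  by case: nz => nza _ _; split; apply: norm_quat_split.
- case=> a [b [c [/deg_sqrt3_indep[nz ind] [Qb Qc]]]].
  have [nza nzb nzc] := nz.
  have nsqa : ~ nz_square a by have := ind true false false isT; rewrite !mulr1 expr1.
  exists a, b, c; split=> //; split.
    split=> //; first by have := ind false true false isT; rewrite mul1r mulr1 expr1.
    by have := ind false false true isT; rewrite !mul1r expr1.
  by split=> //; split; apply: quat_split_norm.
- case=> a [b [c [[nza _ _] [[nsqa _ _] [ind [Nb Nc]]]]]].
  by exists a; do 2!split=> //; apply: independent_norms_card Nb Nc ind.
- case=> a [nza [nsqa /(norm_card_independent char_ne2 nza nsqa)[b [c [Nb Nc ind]]]]].
  have [p [q [nzb' nzc' ind']]] := norm_rescale nza Nb Nc ind.
  exact: DwedgeD_realizable nza nzb' nzc' ind'.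
Qed.
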